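(* Let $R$ be a commutative noetherian algebra over a field $k$, and let $L$ be a finitely generated $R$-module. Let $\alpha$ be an $R$-module endomorphism of $L$ with $\operatorname{Im}\alpha=\operatorname{Ker}\alpha$, and let $x\in R$ be an $L$-regular element. Then the following hold. (1) Any submodule $M$ of $L$ containing $\alpha(L)+xL$ degenerates to $N:=\alpha(M)+x^2L$. (2) With $M$ and $N$ as in (1), if $L$ and $M$ are Cohen-Macaulay, then so is $N$.
   Context: Degeneration: let $R$ be a noetherian algebra over a field $k$ and let $M,N$ be finitely generated $R$-modules. We say that $M$ degenerates to $N$ if there exist a discrete valuation ring $V$ that is a $k$-algebra, with maximal ideal $tV$ and residue field $k$, and a finitely generated $R\otimes_k V$-module $Q$ such that $Q$ is flat as a $V$-module, $Q/tQ\cong N$ as $R$-modules, and $Q_t\cong M\otimes_k V_t$ as $R\otimes_k V_t$-modules (subscript $t$ denotes inverting $t$). Cohen-Macaulay means maximal Cohen-Macaulay: a finitely generated module $M$ over a commutative noetherian ring $R$ is Cohen-Macaulay if $\operatorname{depth}_{R_{\mathfrak p}}M_{\mathfrak p}\ge\dim R_{\mathfrak p}$ for all prime ideals $\mathfrak p$ of $R$ (the zero module has depth $\infty$). *)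

(* Defs.v *)
From HB Require Import structures.
From mathcomp Require Import all_boot all_order all_algebra.
From mathcomp Require Import ring.
From mathcomp Require Import boolp.

Set Implicit Arguments.
Unset Strict Implicit.
Unset Printing Implicit Defensive.

Import GRing.Theory.

Local Open Scope ring_scope.
Local Open Scope quotient_scope.

(* Rings are [comPzRingType]s, so the zero ring is allowed.  An algebra over a
   field [k] is a ring with a structure morphism [i : {rmorphism k -> R}]. *)

Section Submodules.
Variables (A : comPzRingType) (X : lmodType A).

Record submod (S : submodClosed X) := Submod {
  submod_val :> X; _ : submod_val \in S }.

HB.instance Definition _ S := [isSub for @submod_val S].
HB.instance Definition _ S := [Choice of submod S by <:].
HB.instance Definition _ S := [SubChoice_isSubLmodule of submod S by <:].

Definition full_sub : {pred X} := [pred _ | true].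

Lemma full_sub_closed : subsemimod_closed full_sub.
Proof. by []. Qed.
HB.instance Definition _ := GRing.isSubSemiModClosed.Build A X full_sub
  full_sub_closed.

Definition add_sub (S S' : {pred X}) : {pred X} :=
  [pred x | `[< exists y z, [/\ y \in S, z \in S' & x = y + z] >]].

Lemma add_sub_closed (S S' : submodClosed X) :
  subsemimod_closed (add_sub S S').
Proof.
split; [split; [|move=> x y]|move=> a x]; rewrite !inE /=.
- by apply/asboolP; exists 0, 0; rewrite !rpred0 addr0.
- move=> /asboolP[x1 [x2 [? ? ->]]] /asboolP[y1 [y2 [? ? ->]]].
  by apply/asboolP; exists (x1 + y1), (x2 + y2); rewrite !rpredD// addrACA.
- move=> /asboolP[x1 [x2 [? ? ->]]].
  by apply/asboolP; exists (a *: x1), (a *: x2); rewrite !rpredZ// scalerDr.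
Qed.
HB.instance Definition _ (S S' : submodClosed X) :=
  GRing.isSubSemiModClosed.Build A X (add_sub S S') (add_sub_closed S S').

(* [ideal_mul s] is the submodule (s_1, ..., s_n) X of X. *)
Definition ideal_mul (s : seq A) : {pred X} :=
  [pred x | `[< exists y : 'I_(size s) -> X,
                  x = \sum_(i < size s) s`_i *: y i >]].

Lemma ideal_mul_closed s : subsemimod_closed (ideal_mul s).
Proof.
split; [split; [|move=> x y]|move=> a x]; rewrite !inE /=.
- apply/asboolP; exists (fun=> 0).
  by rewrite big1 // => i _; rewrite scaler0.
- move=> /asboolP[f ->] /asboolP[g ->].
  apply/asboolP; exists (fun i => f i + g i).
  by rewrite -big_split; apply: eq_bigr => i _; rewrite scalerDr.
- move=> /asboolP[f ->]; apply/asboolP; exists (fun i => a *: f i).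
  by rewrite scaler_sumr; apply: eq_bigr => i _; rewrite !scalerA mulrC.
Qed.
HB.instance Definition _ s :=
  GRing.isSubSemiModClosed.Build A X (ideal_mul s) (ideal_mul_closed s).

Definition fin_gen : Prop := exists s : seq X,
  forall x, exists a : 'I_(size s) -> A, x = \sum_(i < size s) a i *: s`_i.

Definition regular_elt (a : A) : Prop := forall x : X, a *: x = 0 -> x = 0.

End Submodules.

Arguments full_sub {A} X.
Arguments ideal_mul {A} X s.
Arguments fin_gen {A} X.
Arguments regular_elt {A} X a.

Section ImageSub.
Variables (A : comPzRingType) (X Y : lmodType A) (f : {linear X -> Y}).

Definition im_sub (S : {pred X}) : {pred Y} :=
  [pred y | `[< exists2 x, x \in S & y = f x >]].

Lemma im_sub_closed (S : submodClosed X) : subsemimod_closed (im_sub S).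
Proof.
split; [split; [|move=> x y]|move=> a x]; rewrite !inE /=.
- by apply/asboolP; exists 0; rewrite ?rpred0 ?raddf0.
- move=> /asboolP[x' ? ->] /asboolP[y' ? ->].
  by apply/asboolP; exists (x' + y'); rewrite ?rpredD ?raddfD.
- move=> /asboolP[x' ? ->].
  by apply/asboolP; exists (a *: x'); rewrite ?rpredZ ?linearZ.
Qed.
HB.instance Definition _ (S : submodClosed X) :=
  GRing.isSubSemiModClosed.Build A Y (im_sub S) (im_sub_closed S).

End ImageSub.

Definition lmod_iso (A : comPzRingType) (X Y : lmodType A) : Prop :=
  exists f : {linear X -> Y}, bijective f.

Definition noetherian (A : comPzRingType) : Prop :=
  forall I : submodClosed A^o, fin_gen (submod I).

Section QuotientModule.
Variables (A : comPzRingType) (X : lmodType A) (S : submodClosed X).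

Lemma rpredNS x : x \in S -> - x \in S.
Proof. by move=> Sx; rewrite -scaleN1r rpredZ. Qed.

Definition quotm_rel : rel X := fun x y => x - y \in S.

Lemma quotm_rel_refl : reflexive quotm_rel.
Proof. by move=> x; rewrite /quotm_rel subrr rpred0. Qed.
Lemma quotm_rel_sym : symmetric quotm_rel.
Proof. by move=> x y; apply/idP/idP => /rpredNS; rewrite opprB. Qed.
Lemma quotm_rel_trans : transitive quotm_rel.
Proof. by move=> y x z Sxy Syz; rewrite /quotm_rel -(subrKA y) rpredD. Qed.

Definition quotm_equiv :=
  EquivRel quotm_rel quotm_rel_refl quotm_rel_sym quotm_rel_trans.

Definition quotm := {eq_quot quotm_equiv}.
HB.instance Definition _ := Choice.on quotm.
HB.instance Definition _ : EqQuotient X quotm_equiv quotm :=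
  EqQuotient.on quotm.

Lemma quotmP (x y : X) : x - y \in S <-> \pi_quotm x = \pi_quotm y.
Proof.
by split=> [h|/(@eqmodP _ quotm_equiv) //]; apply/(@eqmodP _ quotm_equiv).
Qed.

Lemma quotm_surj (z : quotm) : exists x, z = \pi_quotm x.
Proof. by exists (repr z); rewrite reprK. Qed.

(* These and similar operations below are [locked] to stop unification from
   unfolding them. *)
Definition quotm_add : quotm -> quotm -> quotm :=
  locked (fun x y => \pi_quotm (repr x + repr y)).
Definition quotm_opp : quotm -> quotm := locked (fun x => \pi_quotm (- repr x)).
Definition quotm_scale : A -> quotm -> quotm :=
  locked (fun a x => \pi_quotm (a *: repr x)).

Lemma quotm_addE x y : quotm_add (\pi_quotm x) (\pi y) = \pi_quotm (x + y).
Proof.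
rewrite /quotm_add -lock; apply/quotmP; rewrite opprD addrACA.
by rewrite rpredD//; apply/quotmP; rewrite reprK.
Qed.
Lemma quotm_oppE x : quotm_opp (\pi_quotm x) = \pi_quotm (- x).
Proof.
rewrite /quotm_opp -lock; apply/quotmP; rewrite -opprD.
by rewrite rpredNS//; apply/quotmP; rewrite reprK.
Qed.
Lemma quotm_scaleE a x : quotm_scale a (\pi_quotm x) = \pi_quotm (a *: x).
Proof.
rewrite /quotm_scale -lock; apply/quotmP; rewrite -scalerBr.
by rewrite rpredZ//; apply/quotmP; rewrite reprK.
Qed.

Lemma quotm_addA : associative quotm_add.
Proof.
move=> x y z; have [{}x ->] := quotm_surj x; have [{}y ->] := quotm_surj y.
by have [{}z ->] := quotm_surj z; rewrite !quotm_addE addrA.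
Qed.
Lemma quotm_addC : commutative quotm_add.
Proof.
move=> x y; have [{}x ->] := quotm_surj x; have [{}y ->] := quotm_surj y.
by rewrite !quotm_addE addrC.
Qed.
Lemma quotm_add0 : left_id (\pi_quotm 0) quotm_add.
Proof.
by move=> x; have [{}x ->] := quotm_surj x; rewrite quotm_addE add0r.
Qed.
Lemma quotm_addN : left_inverse (\pi_quotm 0) quotm_opp quotm_add.
Proof.
move=> x; have [{}x ->] := quotm_surj x.
by rewrite quotm_oppE quotm_addE addNr.
Qed.
HB.instance Definition _ := GRing.isZmodule.Build quotm
  quotm_addA quotm_addC quotm_add0 quotm_addN.

Lemma quotmD x y : \pi_quotm x + \pi_quotm y = \pi_quotm (x + y).
Proof. exact: quotm_addE. Qed.

Lemma quotm_scaleA a b x :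
  quotm_scale a (quotm_scale b x) = quotm_scale (a * b) x.
Proof. by have [{}x ->] := quotm_surj x; rewrite !quotm_scaleE scalerA. Qed.
Lemma quotm_scale1 : left_id 1 quotm_scale.
Proof.
by move=> x; have [{}x ->] := quotm_surj x; rewrite quotm_scaleE scale1r.
Qed.
Lemma quotm_scaleDr : right_distributive quotm_scale +%R.
Proof.
move=> a x y; have [{}x ->] := quotm_surj x; have [{}y ->] := quotm_surj y.
by rewrite quotmD !quotm_scaleE quotmD scalerDr.
Qed.
Lemma quotm_scaleDl x : {morph quotm_scale^~ x : a b / a + b}.
Proof.
have [{}x ->] := quotm_surj x => a b.
by rewrite /= !quotm_scaleE quotmD scalerDl.
Qed.
HB.instance Definition _ := GRing.Zmodule_isLmodule.Build A quotm
  quotm_scaleA quotm_scale1 quotm_scaleDr quotm_scaleDl.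

End QuotientModule.

(* [restr f X] is the [B]-module [X] seen as an [A]-module along [f]. *)
Definition restr (A B : comPzRingType) (f : {rmorphism A -> B})
  (X : lmodType B) : Type := X.
HB.instance Definition _ A B f X := GRing.Zmodule.on (@restr A B f X).

Section RestrictScalars.
Variables (A B : comPzRingType) (f : {rmorphism A -> B}) (X : lmodType B).
Local Notation restr := (restr f X).

Definition restr_scale (a : A) (x : restr) : restr := f a *: (x : X).

Lemma restr_scaleA a b x :
  restr_scale a (restr_scale b x) = restr_scale (a * b) x.
Proof. by rewrite /restr_scale scalerA rmorphM. Qed.
Lemma restr_scale1 : left_id 1 restr_scale.
Proof. by move=> x; rewrite /restr_scale rmorph1 scale1r. Qed.
Lemma restr_scaleDr : right_distributive restr_scale +%R.
Proof. by move=> a x y; rewrite /restr_scale scalerDr. Qed.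
Lemma restr_scaleDl x : {morph restr_scale^~ x : a b / a + b}.
Proof. by move=> a b; rewrite /restr_scale /= rmorphD scalerDl. Qed.
HB.instance Definition _ := GRing.Zmodule_isLmodule.Build A restr
  restr_scaleA restr_scale1 restr_scaleDr restr_scaleDl.

End RestrictScalars.

(* Localization of rings ([locr S]) and of modules ([loc S X]) at a
   multiplicative subset: classes of fractions x / s. *)
Section Localization.
Variables (A : comPzRingType) (S : mulrClosed A).

Definition denom := {s : A | s \in S}.
Definition denom1 : denom := exist _ 1 (rpred1 S).
Definition denomM (s s' : denom) : denom :=
  exist _ (sval s * sval s') (rpredM (valP s) (valP s')).

Section LocModule.
Variable X : lmodType A.

Definition loc_rel : rel (X * denom) := fun p q =>
  `[< exists2 u, u \in S & u *: (sval q.2 *: p.1) = u *: (sval p.2 *: q.1) >].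

Lemma loc_rel_refl : reflexive loc_rel.
Proof. by move=> p; apply/asboolP; exists 1 => //; exact: rpred1. Qed.
Lemma loc_rel_sym : symmetric loc_rel.
Proof.
by move=> p q; apply/idP/idP => /asboolP[u Su e]; apply/asboolP; exists u.
Qed.
Lemma loc_rel_trans : transitive loc_rel.
Proof.
move=> q p r /asboolP[u Su e] /asboolP[v Sv e']; apply/asboolP.
exists (u * v * sval q.2); first by rewrite !rpredM// (valP q.2).
move: e e'; rewrite !scalerA => e e'.
transitivity ((v * sval r.2) *: ((u * sval q.2) *: p.1)).
  by rewrite scalerA; congr (_ *: _); ring.
rewrite e scalerA; transitivity ((u * sval p.2) *: ((v * sval r.2) *: q.1)).
  by rewrite scalerA; congr (_ *: _); ring.
by rewrite e' !scalerA; congr (_ *: _); ring.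
Qed.

Definition loc_equiv := EquivRel loc_rel loc_rel_refl loc_rel_sym loc_rel_trans.

Definition loc := {eq_quot loc_equiv}.
HB.instance Definition _ := Choice.on loc.
HB.instance Definition _ : EqQuotient (X * denom)%type loc_equiv loc :=
  EqQuotient.on loc.

Definition frac (x : X) (s : denom) : loc := \pi_loc (x, s).

Lemma fracP x s y s' : frac x s = frac y s' <->
  exists2 u, u \in S & u *: (sval s' *: x) = u *: (sval s *: y).
Proof.
split=> [/(@eqmodP _ loc_equiv (x, s) (y, s'))/asboolP //|h].
by apply/(@eqmodP _ loc_equiv (x, s) (y, s'))/asboolP.
Qed.

Lemma frac_eq x s y s' : sval s' *: x = sval s *: y -> frac x s = frac y s'.
Proof. by move=> e; apply/fracP; exists 1; [exact: rpred1|rewrite e]. Qed.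

Lemma frac_surj (z : loc) : exists x s, z = frac x s.
Proof.
exists (repr z).1, (repr z).2; rewrite /frac -surjective_pairing.
by rewrite reprK.
Qed.

End LocModule.

Lemma fracK (X : lmodType A) (z : loc X) : frac (repr z).1 (repr z).2 = z.
Proof. by rewrite /frac -surjective_pairing reprK. Qed.

Section LocOps.
Variable X : lmodType A.

Definition loc_add : loc X -> loc X -> loc X := locked (fun z w =>
  frac (sval (repr w).2 *: (repr z).1 + sval (repr z).2 *: (repr w).1)
       (denomM (repr z).2 (repr w).2)).
Definition loc_opp : loc X -> loc X :=
  locked (fun z => frac (- (repr z).1) (repr z).2).
Definition loc_scale : loc A^o -> loc X -> loc X := locked (fun c z =>
  frac (((repr c).1 : A) *: (repr z).1) (denomM (repr c).2 (repr z).2)).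

Lemma loc_addE x s y s' : loc_add (frac x s) (frac y s') =
  frac (sval s' *: x + sval s *: y) (denomM s s').
Proof.
rewrite /loc_add -lock.
have /fracP[u Su e] := fracK (frac x s).
have /fracP[v Sv e'] := fracK (frac y s').
move: (repr (frac x s)) (repr (frac y s')) e e' => [x0 s0] [y0 s0'] /= e e'.
apply/fracP; exists (u * v); first by rewrite rpredM.
rewrite /= !scalerDr; move: e e'; rewrite !scalerA => e e'; congr (_ + _).
  transitivity ((v * sval s' * sval s0') *: ((u * sval s) *: x0)).
    by rewrite scalerA; congr (_ *: _); ring.
  by rewrite e scalerA; congr (_ *: _); ring.
transitivity ((u * sval s * sval s0) *: ((v * sval s') *: y0)).
  by rewrite scalerA; congr (_ *: _); ring.
by rewrite e' scalerA; congr (_ *: _); ring.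
Qed.

Lemma loc_oppE x s : loc_opp (frac x s) = frac (- x) s.
Proof.
rewrite /loc_opp -lock; have /fracP[u Su e] := fracK (frac x s).
by apply/fracP; exists u; rewrite // !scalerN e.
Qed.

Lemma loc_scaleE (a : A) s x s' :
  loc_scale (frac (a : A^o) s) (frac x s') = frac (a *: x) (denomM s s').
Proof.
rewrite /loc_scale -lock.
have /fracP[u Su e] := fracK (frac (a : A^o) s).
have /fracP[v Sv e'] := fracK (frac x s').
move: (repr (frac (a : A^o) s)) (repr (frac x s')) e e'.
move=> [a0 s0] [x0 s0'] /= e e'.
apply/fracP; exists (u * v); first by rewrite rpredM.
have {}e : u * (sval s * a0) = u * (sval s0 * a) := e.
move: e'; rewrite /= !scalerA => e'.
transitivity ((u * (sval s * a0)) *: ((v * sval s') *: x0)).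
  by rewrite scalerA; congr (_ *: _); ring.
by rewrite e' e scalerA; congr (_ *: _); ring.
Qed.

Lemma loc_addA : associative loc_add.
Proof.
move=> x y z; have [{}x [s ->]] := frac_surj x.
have [{}y [t ->]] := frac_surj y; have [{}z [u ->]] := frac_surj z.
rewrite !loc_addE; apply: frac_eq; rewrite /= !scalerDr !scalerA addrA.
by congr (_ *: _ + _ *: _ + _ *: _); ring.
Qed.
Lemma loc_addC : commutative loc_add.
Proof.
move=> x y; have [{}x [s ->]] := frac_surj x.
have [{}y [t ->]] := frac_surj y.
rewrite !loc_addE; apply: frac_eq; rewrite /= addrC !scalerDr !scalerA.
by congr (_ *: _ + _ *: _); ring.
Qed.
Lemma loc_add0 : left_id (frac 0 denom1) loc_add.
Proof.
move=> x; have [{}x [s ->]] := frac_surj x.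
by rewrite loc_addE; apply: frac_eq; rewrite /= scaler0 add0r scale1r mul1r.
Qed.
Lemma loc_addN : left_inverse (frac 0 denom1) loc_opp loc_add.
Proof.
move=> x; have [{}x [s ->]] := frac_surj x.
rewrite loc_oppE loc_addE; apply: frac_eq.
by rewrite /= scalerN addNr !scaler0.
Qed.
HB.instance Definition _ := GRing.isZmodule.Build (loc X)
  loc_addA loc_addC loc_add0 loc_addN.

Lemma fracD x s y t : frac x s + frac y t =
  frac (sval t *: x + sval s *: y) (denomM s t).
Proof. exact: loc_addE. Qed.

Lemma loc_scaleDr : right_distributive loc_scale +%R.
Proof.
move=> c x y; have [{}c [s ->]] := frac_surj c.
have [{}x [t ->]] := frac_surj x; have [{}y [u ->]] := frac_surj y.
rewrite fracD !loc_scaleE fracD; apply: frac_eq.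
rewrite /= !scalerDr !scalerA.
by congr (_ *: _ + _ *: _); ring.
Qed.
End LocOps.

Definition locr : Type := loc A^o.
HB.instance Definition _ := GRing.Zmodule.on locr.
Definition fracr (a : A) (s : denom) : locr := frac (a : A^o) s.

Lemma fracr_surj (z : locr) : exists a s, z = fracr a s.
Proof. exact: (@frac_surj A^o). Qed.

Lemma fracr_eq (a : A) s b t : sval t * a = sval s * b -> fracr a s = fracr b t.
Proof. exact: (@frac_eq A^o). Qed.

Lemma fracrD (a : A) s b t :
  fracr a s + fracr b t = fracr (sval t * a + sval s * b) (denomM s t).
Proof. exact: (@fracD A^o). Qed.

Definition locr_mul : locr -> locr -> locr := @loc_scale A^o.

Lemma locr_mulE (a : A) s b t :
  locr_mul (fracr a s) (fracr b t) = fracr (a * b) (denomM s t).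
Proof. exact: (@loc_scaleE A^o). Qed.

Lemma locr_mulA : associative locr_mul.
Proof.
move=> x y z; have [{}x [s ->]] := fracr_surj x.
have [{}y [t ->]] := fracr_surj y; have [{}z [u ->]] := fracr_surj z.
by rewrite !locr_mulE; apply: fracr_eq => /=; ring.
Qed.
Lemma locr_mulC : commutative locr_mul.
Proof.
move=> x y; have [{}x [s ->]] := fracr_surj x.
have [{}y [t ->]] := fracr_surj y.
by rewrite !locr_mulE; apply: fracr_eq => /=; ring.
Qed.
Lemma locr_mul1 : left_id (fracr 1 denom1) locr_mul.
Proof.
move=> x; have [{}x [s ->]] := fracr_surj x.
by rewrite !locr_mulE; apply: fracr_eq => /=; ring.
Qed.
Lemma locr_mulDl : left_distributive locr_mul +%R.
Proof.
move=> x y z; rewrite locr_mulC [X in _ = X + _]locr_mulC.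
by rewrite [X in _ = _ + X]locr_mulC; exact: (@loc_scaleDr A^o).
Qed.
HB.instance Definition _ := GRing.Zmodule_isComPzRing.Build locr
  locr_mulA locr_mulC locr_mul1 locr_mulDl.

Lemma fracrM (a : A) s b t :
  fracr a s * fracr b t = fracr (a * b) (denomM s t).
Proof. exact: locr_mulE. Qed.

Section LocLmodule.
Variable X : lmodType A.

Definition locr_scale : locr -> loc X -> loc X := @loc_scale X.

Lemma locr_scaleE (a : A) s (x : X) t :
  locr_scale (fracr a s) (frac x t) = frac (a *: x) (denomM s t).
Proof. exact: loc_scaleE. Qed.

Lemma locr_scaleA a b x :
  locr_scale a (locr_scale b x) = locr_scale (a * b) x.
Proof.
have [{}a [s ->]] := fracr_surj a; have [{}b [t ->]] := fracr_surj b.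
have [{}x [u ->]] := frac_surj x.
rewrite fracrM !locr_scaleE; apply: frac_eq; rewrite /= !scalerA.
by congr (_ *: _); ring.
Qed.
Lemma locr_scale1 : left_id 1 locr_scale.
Proof.
move=> x; have [{}x [s ->]] := frac_surj x.
rewrite [1]/(fracr 1 denom1) locr_scaleE; apply: frac_eq.
by rewrite /= !scalerA; congr (_ *: _); ring.
Qed.
Lemma locr_scaleDr : right_distributive locr_scale +%R.
Proof. exact: loc_scaleDr. Qed.
Lemma locr_scaleDl x : {morph locr_scale^~ x : a b / a + b}.
Proof.
move=> a b; have [{}a [s ->]] := fracr_surj a.
have [{}b [t ->]] := fracr_surj b; have [{}x [u ->]] := frac_surj x.
rewrite fracrD /= !locr_scaleE fracD; apply: frac_eq.
rewrite /= !(scalerDl, scalerDr) !scalerA -!scalerDl.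
by congr (_ *: _); ring.
Qed.
HB.instance Definition _ := GRing.Zmodule_isLmodule.Build locr (loc X)
  locr_scaleA locr_scale1 locr_scaleDr locr_scaleDl.

Lemma fracZ (a : A) s (x : X) t :
  fracr a s *: frac x t = frac (a *: x) (denomM s t).
Proof. exact: locr_scaleE. Qed.

End LocLmodule.

Definition to_loc (a : A) : locr := fracr a denom1.

Lemma to_loc_zmod_morphism : zmod_morphism to_loc.
Proof.
move=> a b; rewrite /to_loc.
rewrite -[RHS]/(fracr a denom1 + loc_opp (frac (b : A^o) _)).
by rewrite loc_oppE fracrD; apply: fracr_eq => /=; ring.
Qed.
Lemma to_loc_monoid_morphism : monoid_morphism to_loc.
Proof. by split=> // a b; rewrite fracrM; apply: fracr_eq => /=; ring. Qed.
HB.instance Definition _ :=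
  GRing.isZmodMorphism.Build A locr to_loc to_loc_zmod_morphism.
HB.instance Definition _ :=
  GRing.isMonoidMorphism.Build A locr to_loc to_loc_monoid_morphism.

End Localization.

Section Tensor.
Variables (k : comPzRingType) (X Y : lmodType k).

(* The tensor product is the quotient of the free commutative monoid on
   [X * Y] (lists up to permutation) by the bilinearity relations; it is
   a group because [(- x, y)] is an opposite of [(x, y)]. *)
Inductive tens_eq : seq (X * Y) -> seq (X * Y) -> Prop :=
| TensRefl s : tens_eq s s
| TensSym s t : tens_eq s t -> tens_eq t s
| TensTrans s t u : tens_eq s t -> tens_eq t u -> tens_eq s u
| TensCat s s' t t' :
    tens_eq s s' -> tens_eq t t' -> tens_eq (s ++ t) (s' ++ t')
| TensComm s t : tens_eq (s ++ t) (t ++ s)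
| TensAddl x x' y : tens_eq [:: (x + x', y)] [:: (x, y); (x', y)]
| TensAddr x y y' : tens_eq [:: (x, y + y')] [:: (x, y); (x, y')]
| TensScale a x y : tens_eq [:: (a *: x, y)] [:: (x, a *: y)]
| TensZero y : tens_eq [:: (0, y)] [::].

Definition tens_rel : rel (seq (X * Y)) := fun s t => `[< tens_eq s t >].

Lemma tens_rel_refl : reflexive tens_rel.
Proof. by move=> s; apply/asboolP; exact: TensRefl. Qed.
Lemma tens_rel_sym : symmetric tens_rel.
Proof. by move=> s t; apply/idP/idP => /asboolP/TensSym/asboolP. Qed.
Lemma tens_rel_trans : transitive tens_rel.
Proof.
move=> t s u /asboolP st /asboolP tu; apply/asboolP; exact: TensTrans st tu.
Qed.

Definition tens_equiv :=
  EquivRel tens_rel tens_rel_refl tens_rel_sym tens_rel_trans.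

Definition tensor := {eq_quot tens_equiv}.
HB.instance Definition _ := Choice.on tensor.
HB.instance Definition _ : EqQuotient (seq (X * Y)) tens_equiv tensor :=
  EqQuotient.on tensor.

Definition tens_cls (s : seq (X * Y)) : tensor := \pi_tensor s.

Lemma tens_clsP s t : tens_cls s = tens_cls t <-> tens_eq s t.
Proof.
split=> [/(@eqmodP _ tens_equiv)/asboolP //|h].
by apply/(@eqmodP _ tens_equiv)/asboolP.
Qed.

Lemma tens_surj (z : tensor) : exists s, z = tens_cls s.
Proof. by exists (repr z); rewrite /tens_cls reprK. Qed.

Lemma tens_repr s : tens_eq (repr (tens_cls s)) s.
Proof. by apply/tens_clsP; rewrite /tens_cls reprK. Qed.

Definition tens_add : tensor -> tensor -> tensor :=
  locked (fun z w => tens_cls (repr z ++ repr w)).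
Definition tens_opp : tensor -> tensor :=
  locked (fun z => tens_cls [seq (- p.1, p.2) | p <- repr z]).
Definition tens_scale : k -> tensor -> tensor :=
  locked (fun a z => tens_cls [seq (a *: p.1, p.2) | p <- repr z]).

Lemma tens_eq_map (f : X -> X) : f 0 = 0 -> {morph f : x y / x + y} ->
  (forall a, {morph f : x / a *: x}) -> forall s t, tens_eq s t ->
  tens_eq [seq (f p.1, p.2) | p <- s] [seq (f p.1, p.2) | p <- t].
Proof.
move=> f0 fD fZ s t; elim=> {s t} //=.
- by move=> s; exact: TensRefl.
- by move=> s t _; exact: TensSym.
- by move=> s t u _ h _; exact: TensTrans.
- by move=> s s' t t' _ h _ h'; rewrite !map_cat; exact: TensCat.
- by move=> s t; rewrite !map_cat; exact: TensComm.
- by move=> x x' y; rewrite fD; exact: TensAddl.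
- by move=> x y y'; exact: TensAddr.
- by move=> a x y; rewrite fZ; exact: TensScale.
- by move=> y; rewrite f0; exact: TensZero.
Qed.

Lemma tens_addE s t : tens_add (tens_cls s) (tens_cls t) = tens_cls (s ++ t).
Proof.
by rewrite /tens_add -lock; apply/tens_clsP; apply: TensCat; exact: tens_repr.
Qed.
Lemma tens_oppE s :
  tens_opp (tens_cls s) = tens_cls [seq (- p.1, p.2) | p <- s].
Proof.
rewrite /tens_opp -lock; apply/tens_clsP.
apply: tens_eq_map; [exact: oppr0|exact: opprD| |exact: tens_repr].
by move=> a x; rewrite scalerN.
Qed.
Lemma tens_scaleE a s :
  tens_scale a (tens_cls s) = tens_cls [seq (a *: p.1, p.2) | p <- s].
Proof.
rewrite /tens_scale -lock; apply/tens_clsP.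
apply: (@tens_eq_map ( *:%R a));
  [exact: scaler0|exact: scalerDr| |exact: tens_repr].
by move=> b x; rewrite !scalerA mulrC.
Qed.

Lemma tens_addA : associative tens_add.
Proof.
move=> x y z; have [{}x ->] := tens_surj x; have [{}y ->] := tens_surj y.
by have [{}z ->] := tens_surj z; rewrite !tens_addE catA.
Qed.
Lemma tens_addC : commutative tens_add.
Proof.
move=> x y; have [{}x ->] := tens_surj x; have [{}y ->] := tens_surj y.
by rewrite !tens_addE; apply/tens_clsP; exact: TensComm.
Qed.
Lemma tens_add0 : left_id (tens_cls [::]) tens_add.
Proof. by move=> x; have [{}x ->] := tens_surj x; rewrite tens_addE. Qed.
Lemma tens_addN : left_inverse (tens_cls [::]) tens_opp tens_add.
Proof.
move=> x; have [{}x ->] := tens_surj x.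
rewrite tens_oppE tens_addE; apply/tens_clsP.
elim: x => [|[x y] s ih] /=; first exact: TensRefl.
set u := map _ _ in ih *.
apply: (TensTrans (t := ([:: (- x, y)] ++ [:: (x, y)]) ++ (s ++ u))).
  exact: (TensCat (s := [:: (- x, y)]) (TensRefl _) (TensComm u ((x, y) :: s))).
apply: (TensTrans (t := [::] ++ [::])); last exact: TensRefl.
apply: TensCat; last exact: TensTrans (TensComm _ _) ih.
apply: TensTrans (TensSym (TensAddl _ _ _)) _.
by rewrite addNr; exact: TensZero.
Qed.
HB.instance Definition _ := GRing.isZmodule.Build tensor
  tens_addA tens_addC tens_add0 tens_addN.

Definition tens (x : X) (y : Y) : tensor := tens_cls [:: (x, y)].

Lemma tens_clsE s : tens_cls s = \sum_(p <- s) tens p.1 p.2.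
Proof.
elim: s => [|[x y] s ih]; first by rewrite big_nil.
by rewrite big_cons -ih -[RHS]/(tens_add _ _) tens_addE.
Qed.

Lemma tensDl y : {morph tens^~ y : x x' / x + x'}.
Proof.
move=> x x'; rewrite -[RHS]/(tens_add _ _) tens_addE.
by apply/tens_clsP; exact: TensAddl.
Qed.
Lemma tensDr x : {morph tens x : y y' / y + y'}.
Proof.
move=> y y'; rewrite -[RHS]/(tens_add _ _) tens_addE.
by apply/tens_clsP; exact: TensAddr.
Qed.
Lemma tensZlr a x y : tens (a *: x) y = tens x (a *: y).
Proof. by apply/tens_clsP; exact: TensScale. Qed.
Lemma tens0l y : tens 0 y = 0.
Proof. by apply: (addrI (tens 0 y)); rewrite -tensDl !addr0. Qed.

Lemma tens_ind (P : tensor -> Prop) : P 0 ->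
  (forall z w, P z -> P w -> P (z + w)) -> (forall x y, P (tens x y)) ->
  forall z, P z.
Proof.
move=> P0 PD Pt z; have [s ->] := tens_surj z; rewrite tens_clsE.
by elim/big_ind: _.
Qed.

Lemma tens_scale_pure a x y : tens_scale a (tens x y) = tens (a *: x) y.
Proof. exact: tens_scaleE. Qed.
Lemma tens_scaleDr : right_distributive tens_scale +%R.
Proof.
move=> a x y; have [{}x ->] := tens_surj x; have [{}y ->] := tens_surj y.
rewrite -[_ + _]/(tens_add _ _) -[RHS]/(tens_add _ _).
by rewrite tens_addE !tens_scaleE tens_addE map_cat.
Qed.
Lemma tens_scale0 a : tens_scale a 0 = 0.
Proof. by apply: (addrI (tens_scale a 0)); rewrite -tens_scaleDr !addr0. Qed.
Lemma tens_scaleA a b x : tens_scale a (tens_scale b x) = tens_scale (a * b) x.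
Proof.
elim/tens_ind: x => [|x y hx hy|x y]; first by rewrite !tens_scale0.
  by rewrite !tens_scaleDr hx hy.
by rewrite !tens_scale_pure scalerA.
Qed.
Lemma tens_scale1 : left_id 1 tens_scale.
Proof.
elim/tens_ind=> [|x y hx hy|x y]; first by rewrite !tens_scale0.
  by rewrite !tens_scaleDr hx hy.
by rewrite !tens_scale_pure scale1r.
Qed.
Lemma tens_scaleDl x : {morph tens_scale^~ x : a b / a + b}.
Proof.
move=> a b /=; elim/tens_ind: x => [|x y hx hy|x y].
- by rewrite !tens_scale0 addr0.
- by rewrite !tens_scaleDr hx hy addrACA.
- by rewrite !tens_scale_pure scalerDl tensDl.
Qed.
HB.instance Definition _ := GRing.Zmodule_isLmodule.Build k tensor
  tens_scaleA tens_scale1 tens_scaleDr tens_scaleDl.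

Lemma tensZl a x y : a *: tens x y = tens (a *: x) y.
Proof. exact: tens_scale_pure. Qed.

Section Lift.
Variables (G : zmodType) (f : X -> Y -> G).

Definition balanced : Prop :=
  [/\ forall y, {morph f^~ y : x x' / x + x'},
      forall x, {morph f x : y y' / y + y'} &
      forall a x y, f (a *: x) y = f x (a *: y)].

Definition tens_lift : tensor -> G :=
  locked (fun z => \sum_(p <- repr z) f p.1 p.2).

Hypothesis fB : balanced.

Lemma tens_lift_cls s : tens_lift (tens_cls s) = \sum_(p <- s) f p.1 p.2.
Proof.
rewrite /tens_lift -lock; have [fDl fDr fZ] := fB.
move: (tens_repr s); move: (repr _) => t; elim=> {s t} //.
- by move=> s t u _ -> _ ->.
- by move=> s s' t t' _ h _ h'; rewrite !big_cat /= h h'.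
- by move=> s t; rewrite !big_cat /= addrC.
- by move=> x x' y; rewrite !big_cons !big_nil /= fDl !addr0.
- by move=> x y y'; rewrite !big_cons !big_nil /= fDr !addr0.
- by move=> a x y; rewrite !big_cons !big_nil /= fZ.
- move=> y; rewrite big_cons !big_nil /= addr0.
  by apply: (addrI (f 0 y)); rewrite -fDl !addr0.
Qed.

Lemma tens_liftE x y : tens_lift (tens x y) = f x y.
Proof. by rewrite tens_lift_cls big_seq1. Qed.

Lemma tens_liftD : {morph tens_lift : z w / z + w}.
Proof.
move=> z w; have [s ->] := tens_surj z; have [t ->] := tens_surj w.
by rewrite -[_ + _]/(tens_add _ _) tens_addE !tens_lift_cls big_cat.
Qed.

Lemma tens_lift0 : tens_lift 0 = 0.
Proof. by apply: (addrI (tens_lift 0)); rewrite -tens_liftD !addr0. Qed.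

End Lift.
End Tensor.

Section TensorMap.
Variables (k : comPzRingType) (X X' Y : lmodType k) (f : {linear X -> X'}).

Definition tens_mapl : tensor X Y -> tensor X' Y :=
  tens_lift (fun x y => tens (f x) y).

Lemma tens_mapl_balanced : balanced (fun x (y : Y) => tens (f x) y).
Proof.
split=> [y x x'|x y y'|a x y].
- by rewrite raddfD tensDl.
- by rewrite tensDr.
- by rewrite linearZ tensZlr.
Qed.

Lemma tens_maplE x (y : Y) : tens_mapl (tens x y) = tens (f x) y.
Proof. exact/tens_liftE/tens_mapl_balanced. Qed.

End TensorMap.

(* [tmod i j X Y] is [X] ⊗_k [Y] as a module over [tring i j] = A ⊗_k B. *)
Section TensorModule.
Variables (k A B : comPzRingType).
Variables (i : {rmorphism k -> A}) (j : {rmorphism k -> B}).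

Definition tmod (X : lmodType A) (Y : lmodType B) : Type :=
  tensor (restr i X) (restr j Y).
HB.instance Definition _ X Y := GRing.Zmodule.on (tmod X Y).

Definition ptens (X : lmodType A) (Y : lmodType B) (x : X) (y : Y) : tmod X Y :=
  tens (x : restr i X) (y : restr j Y).

Definition tring : Type := tmod A^o B^o.
HB.instance Definition _ := GRing.Zmodule.on tring.

Definition rtens (a : A) (b : B) : tring := ptens (a : A^o) (b : B^o).

Section Action.
Variables (X : lmodType A) (Y : lmodType B).

Lemma ptensDl y : {morph @ptens X Y ^~ y : x x' / x + x'}.
Proof. exact: (@tensDl _ (restr i X) (restr j Y)). Qed.
Lemma ptensDr x : {morph @ptens X Y x : y y' / y + y'}.
Proof. exact: (@tensDr _ (restr i X) (restr j Y)). Qed.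
Lemma ptensZ c (x : X) (y : Y) : ptens (i c *: x) y = ptens x (j c *: y).
Proof. exact: (@tensZlr _ (restr i X) (restr j Y)). Qed.

Lemma ptens_ind (P : tmod X Y -> Prop) : P 0 ->
  (forall z w, P z -> P w -> P (z + w)) -> (forall x y, P (ptens x y)) ->
  forall z, P z.
Proof. exact: tens_ind. Qed.

Definition tact1 (a : A) (b : B) : tmod X Y -> tmod X Y :=
  tens_lift (fun (x : restr i X) (y : restr j Y) =>
               ptens (a *: (x : X)) (b *: (y : Y))).
Definition tact (c : tring) (z : tmod X Y) : tmod X Y :=
  tens_lift (fun (a : restr i A^o) (b : restr j B^o) => tact1 a b z) c.

Lemma tact1_balanced a b :
  balanced (fun (x : restr i X) (y : restr j Y) =>
              ptens (a *: (x : X)) (b *: (y : Y))).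
Proof.
split=> [y x x'|x y y'|c x y].
- by rewrite scalerDr ptensDl.
- by rewrite scalerDr ptensDr.
- rewrite -[c *: x]/(i c *: (x : X)) -[c *: y]/(j c *: (y : Y)).
  by rewrite scalerA mulrC -scalerA ptensZ !scalerA mulrC.
Qed.

Lemma tact1E a b (x : X) (y : Y) :
  tact1 a b (ptens x y) = ptens (a *: x) (b *: y).
Proof. exact: (tens_liftE (tact1_balanced a b)). Qed.
Lemma tact1D a b : {morph tact1 a b : z w / z + w}.
Proof. exact: (tens_liftD (tact1_balanced a b)). Qed.
Lemma tact10 a b : tact1 a b 0 = 0.
Proof. exact: (tens_lift0 (tact1_balanced a b)). Qed.

Lemma tact_balanced z :
  balanced (fun (a : restr i A^o) (b : restr j B^o) => tact1 a b z).
Proof.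
split=> [b a a'|a b b'|c a b];
  (elim/ptens_ind: z => [|z w hz hw|x y]; first by rewrite !tact10 ?addr0).
- by rewrite !tact1D hz hw addrACA.
- by rewrite !tact1E scalerDl ptensDl.
- by rewrite !tact1D hz hw addrACA.
- by rewrite !tact1E scalerDl ptensDr.
- by rewrite !tact1D hz hw.
- rewrite !tact1E -[c *: a]/(i c * (a : A)) -[c *: b]/(j c * (b : B)).
  by rewrite -!scalerA ptensZ.
Qed.

Lemma tactE a b x y :
  tact (rtens a b) (ptens x y) = ptens (a *: x) (b *: y).
Proof. by rewrite /tact (tens_liftE (tact_balanced _)) tact1E. Qed.
Lemma tactDl z : {morph tact^~ z : c d / c + d}.
Proof. exact: (tens_liftD (tact_balanced z)). Qed.
Lemma tact0l z : tact 0 z = 0.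
Proof. exact: (tens_lift0 (tact_balanced z)). Qed.
Lemma tactDr : right_distributive tact +%R.
Proof.
move=> c z w; elim/tens_ind: c => [|c d hc hd|a b].
  by rewrite !tact0l addr0.
  by rewrite !tactDl hc hd addrACA.
by rewrite /tact !(tens_liftE (tact_balanced _)) tact1D.
Qed.
Lemma tact0r c : tact c 0 = 0.
Proof. by apply: (addrI (tact c 0)); rewrite -tactDr !addr0. Qed.
Lemma tact1l : left_id (rtens 1 1) tact.
Proof.
elim/ptens_ind=> [|z w hz hw|x y]; first by rewrite tact0r.
  by rewrite tactDr hz hw.
by rewrite tactE !scale1r.
Qed.
End Action.

Definition tring_mul : tring -> tring -> tring := @tact A^o B^o.

Lemma rtens_ind (P : tring -> Prop) : P 0 ->
  (forall z w, P z -> P w -> P (z + w)) -> (forall a b, P (rtens a b)) ->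
  forall z, P z.
Proof. exact: tens_ind. Qed.

Lemma tactA (X : lmodType A) (Y : lmodType B) c d (z : tmod X Y) :
  tact c (tact d z) = tact (tring_mul c d) z.
Proof.
elim/rtens_ind: c => [|c c' h h'|a b].
- by rewrite /tring_mul !tact0l.
- by rewrite /tring_mul !tactDl h h'.
elim/rtens_ind: d => [|d d' h h'|a' b'].
- by rewrite /tring_mul tact0l !tact0r tact0l.
- by rewrite /tring_mul tactDl !tactDr tactDl h h'.
elim/ptens_ind: z => [|z w h h'|x y].
- by rewrite !tact0r.
- by rewrite !tactDr h h'.
by rewrite !tactE /tring_mul [tact _ (rtens a' b')]tactE tactE !scalerA.
Qed.

Lemma tring_mulA : associative tring_mul.
Proof. by move=> a b c; exact: (@tactA A^o B^o). Qed.
Lemma tring_mulC : commutative tring_mul.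
Proof.
move=> c d; elim/rtens_ind: c => [|c c' h h'|a b].
- by rewrite /tring_mul tact0l tact0r.
- by rewrite /tring_mul tactDl tactDr; congr (_ + _).
elim/rtens_ind: d => [|d d' h h'|a' b'].
- by rewrite /tring_mul tact0l tact0r.
- by rewrite /tring_mul tactDl tactDr; congr (_ + _).
rewrite /tring_mul !tactE; congr ptens; exact: mulrC.
Qed.
Lemma tring_mulDl : left_distributive tring_mul +%R.
Proof. by move=> a b c; exact: (@tactDl A^o B^o). Qed.
HB.instance Definition _ := GRing.Zmodule_isComPzRing.Build tring
  tring_mulA tring_mulC (@tact1l A^o B^o) tring_mulDl.

Lemma rtensM a b a' b' : rtens a b * rtens a' b' = rtens (a * a') (b * b').
Proof. exact: tactE. Qed.

Section TmodLmodule.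
Variables (X : lmodType A) (Y : lmodType B).
HB.instance Definition _ := GRing.Zmodule_isLmodule.Build tring (tmod X Y)
  (@tactA X Y) (@tact1l X Y) (@tactDr X Y) (fun z => @tactDl X Y z).

Lemma ptensE a b x y : rtens a b *: @ptens X Y x y = ptens (a *: x) (b *: y).
Proof. exact: tactE. Qed.
End TmodLmodule.

Definition tinl (a : A) : tring := rtens a 1.
Definition tinr (b : B) : tring := rtens 1 b.

Lemma morphD_zmod (U W : zmodType) (f : U -> W) :
  {morph f : x y / x + y} -> zmod_morphism f.
Proof.
move=> fD x y; apply: (addIr (f y)); rewrite -fD !subrK //.
Qed.

Lemma tinl_zmod_morphism : zmod_morphism tinl.
Proof. by apply: morphD_zmod => a a'; exact: (@ptensDl A^o B^o). Qed.
Lemma tinl_monoid_morphism : monoid_morphism tinl.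
Proof. by split=> // a a'; rewrite rtensM mul1r. Qed.
HB.instance Definition _ :=
  GRing.isZmodMorphism.Build A tring tinl tinl_zmod_morphism.
HB.instance Definition _ :=
  GRing.isMonoidMorphism.Build A tring tinl tinl_monoid_morphism.

Lemma tinr_zmod_morphism : zmod_morphism tinr.
Proof. by apply: morphD_zmod => b b'; exact: (@ptensDr A^o B^o). Qed.
Lemma tinr_monoid_morphism : monoid_morphism tinr.
Proof. by split=> // b b'; rewrite rtensM mul1r. Qed.
HB.instance Definition _ :=
  GRing.isZmodMorphism.Build B tring tinr tinr_zmod_morphism.
HB.instance Definition _ :=
  GRing.isMonoidMorphism.Build B tring tinr tinr_monoid_morphism.

End TensorModule.

Section Powers.
Variables (A : comPzRingType) (t : A).

Definition powers : {pred A} := [pred s | `[< exists n, s = t ^+ n >]].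

Lemma powers_closed : mulr_closed powers.
Proof.
split=> [|x y]; rewrite !inE; first by apply/asboolP; exists 0%N.
move=> /asboolP[m ->] /asboolP[n ->].
by apply/asboolP; exists (m + n)%N; rewrite exprD.
Qed.
HB.instance Definition _ := GRing.isMulClosed.Build A powers powers_closed.

End Powers.

(* The canonical ring morphism A ⊗_k B_t -> (A ⊗_k B)_t; it is an isomorphism,
   and makes [Q]_t an A ⊗_k B_t-module for every A ⊗_k B-module [Q]. *)
Section TensorLocalization.
Variables (k A B : comPzRingType).
Variables (i : {rmorphism k -> A}) (j : {rmorphism k -> B}).
Variable t : B.

Let S : mulrClosed B := powers t.
Let T : comPzRingType := tring i j.
Let t' : T := tinr i j t.
Let S' : mulrClosed T := powers t'.

Definition to_loc_alg : {rmorphism k -> locr S} := to_loc S \o j.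

Lemma tdenom_proof (s : denom S) : tinr i j (sval s) \in powers t'.
Proof.
have /asboolP[n ->] := valP s.
by apply/asboolP; exists n; rewrite rmorphXn.
Qed.
Definition tdenom (s : denom S) : denom S' :=
  exist (fun s : T => s \in S') _ (tdenom_proof s).

Definition locr_tinr : locr S -> locr S' :=
  locked (fun z => fracr (tinr i j ((repr z).1 : B)) (tdenom (repr z).2)).

Lemma locr_tinrE b s :
  locr_tinr (fracr b s) = fracr (tinr i j b) (tdenom s).
Proof.
rewrite /locr_tinr -lock.
have /fracP[u Su e] := fracK (frac (b : B^o) s).
move: (repr (frac (b : B^o) s)) e => [b0 s0] /= e.
have {}e : u * (sval s * b0) = u * (sval s0 * b) := e.
apply/fracP; exists (tinr i j u); first exact: (tdenom_proof (exist _ u Su)).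
rewrite -![_ *: _]/(_ * _) /=.
by have := congr1 (tinr i j) e; rewrite !rmorphM.
Qed.

Lemma locr_tinrD : {morph locr_tinr : x y / x + y}.
Proof.
move=> x y; have [{}x [s ->]] := fracr_surj x.
have [{}y [u ->]] := fracr_surj y.
rewrite fracrD !locr_tinrE fracrD; apply: fracr_eq.
by rewrite /= rmorphD !rmorphM.
Qed.
Lemma locr_tinrM : {morph locr_tinr : x y / x * y}.
Proof.
move=> x y; have [{}x [s ->]] := fracr_surj x.
have [{}y [u ->]] := fracr_surj y.
rewrite fracrM !locr_tinrE fracrM; apply: fracr_eq.
by rewrite /= !rmorphM.
Qed.
Lemma locr_tinr1 : locr_tinr 1 = 1.
Proof.
rewrite -[1]/(fracr 1 (denom1 S)) locr_tinrE rmorph1.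
by rewrite -[RHS]/(fracr 1 (denom1 S')); apply: fracr_eq; rewrite /= rmorph1.
Qed.

Definition tloc_pure (a : restr i A^o) (b : restr to_loc_alg (locr S)^o) :
  locr S' := to_loc S' (tinl i j a) * locr_tinr b.

Lemma tloc_balanced : balanced tloc_pure.
Proof.
split=> [b a a'|a b b'|c a b]; rewrite /tloc_pure.
- by rewrite !rmorphD mulrDl.
- by rewrite locr_tinrD mulrDr.
rewrite -[c *: a]/(i c * (a : A)) -[c *: b]/(to_loc_alg c * (b : locr S)).
have -> : locr_tinr (to_loc_alg c * b) =
    to_loc S' (tinl i j (i c)) * locr_tinr b.
  rewrite locr_tinrM [to_loc_alg c]/(fracr (j c) (denom1 S)) locr_tinrE.
  congr (_ * _); apply: fracr_eq; rewrite /= rmorph1 !mul1r.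
  have := @ptensZ k A B i j A^o B^o c 1 1.
  by rewrite -[i c *: _]/(i c * 1) -[j c *: _]/(j c * 1) !mulr1.
by rewrite !rmorphM mulrA [X in X * _]mulrC.
Qed.

Definition tloc : tring i to_loc_alg -> locr S' := tens_lift tloc_pure.

Lemma tlocE (a : A) (b : B) s : tloc (rtens i to_loc_alg a (fracr b s)) =
  fracr (rtens i j a b) (tdenom s).
Proof.
rewrite /tloc /rtens (tens_liftE tloc_balanced) /tloc_pure locr_tinrE fracrM.
apply: fracr_eq; rewrite /= mul1r; congr (_ * _).
by rewrite rtensM mul1r mulr1.
Qed.

Lemma tloc_zmod_morphism : zmod_morphism tloc.
Proof. by apply: morphD_zmod; exact: (tens_liftD tloc_balanced). Qed.
Lemma tloc_monoid_morphism : monoid_morphism tloc.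
Proof.
split; first by rewrite [LHS]tlocE; apply: fracr_eq; rewrite /= rmorph1.
have t0 := tens_lift0 tloc_balanced; have tD := tens_liftD tloc_balanced.
move=> c d; elim/rtens_ind: c => [|c c' h h'|a b].
- by rewrite mul0r [tloc 0]t0 mul0r.
- by rewrite mulrDl [LHS]tD [tloc (c + _)]tD mulrDl; congr (_ + _).
elim/rtens_ind: d => [|d d' h h'|a' b'].
- by rewrite mulr0 [tloc 0]t0 mulr0.
- by rewrite mulrDr [LHS]tD [tloc (d + _)]tD mulrDr; congr (_ + _).
have [{}b [s ->]] := fracr_surj b; have [{}b' [u ->]] := fracr_surj b'.
rewrite rtensM fracrM !tlocE fracrM rtensM; apply: fracr_eq.
by rewrite /= rmorphM.
Qed.
HB.instance Definition _ := GRing.isZmodMorphism.Build _ _ tloc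
  tloc_zmod_morphism.
HB.instance Definition _ := GRing.isMonoidMorphism.Build _ _ tloc
  tloc_monoid_morphism.

End TensorLocalization.

Arguments tloc {k A B} i j t _.

Definition flat (A : comPzRingType) (Q : lmodType A) : Prop :=
  forall (X X' : lmodType A) (f : {linear X -> X'}),
    injective f -> injective (tens_mapl f : tensor X Q -> tensor X' Q).

(* A discrete valuation ring is a local principal ideal domain that is not a
   field; "local" is expressed by closure of the nonunits under addition. *)
Definition is_dvr (V : idomainType) : Prop :=
  [/\ forall I : submodClosed V^o, exists a : V, I =i ideal_mul V^o [:: a],
      forall a b : V, a \isn't a GRing.unit -> b \isn't a GRing.unit ->
        a + b \isn't a GRing.unit &
      exists a : V, (a != 0) && (a \isn't a GRing.unit)].

Definition degenerates (k : fieldType) (R : comPzRingType)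
    (i : {rmorphism k -> R}) (M N : lmodType R) : Prop :=
  exists (V : idomainType) (j : {rmorphism k -> V}) (t : V)
         (Q : lmodType (tring i j)),
  let t' := tinr i j t in
  [/\ fin_gen M /\ fin_gen N,
      [/\ is_dvr V,
          forall a : V, a \isn't a GRing.unit <-> a \in ideal_mul V^o [:: t] &
          bijective (fun c : k => \pi_(quotm (ideal_mul V^o [:: t])) (j c))],
      fin_gen Q /\ flat (restr (tinr i j) Q),
      lmod_iso (restr (tinl i j) (quotm (ideal_mul Q [:: t']))) N &
      lmod_iso (restr (tloc i j t) (loc (powers t') Q))
               (tmod i (to_loc_alg j t) M (locr (powers t))^o)].

Record primeIdeal (A : comPzRingType) := PrimeIdeal {
  prime_set :> submodClosed A^o;
  prime1 : (1 : A) \notin prime_set;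
  primeM : forall a b : A, a * b \in prime_set ->
    a \in prime_set \/ b \in prime_set }.

Definition prime_compl (A : comPzRingType) (p : primeIdeal A) : {pred A} :=
  [pred a : A | a \notin (p : {pred A})].

Lemma prime_compl_closed (A : comPzRingType) (p : primeIdeal A) :
  mulr_closed (prime_compl p).
Proof.
split=> [|a b]; rewrite !inE; first exact: prime1.
by move=> na nb; apply/negP => /primeM[]; exact/negP.
Qed.
HB.instance Definition _ (A : comPzRingType) (p : primeIdeal A) :=
  GRing.isMulClosed.Build A (prime_compl p) (prime_compl_closed p).

(* dim A >= n *)
Definition krull_dim_ge (A : comPzRingType) (n : nat) : Prop :=
  exists p : nat -> primeIdeal A, forall m, (m < n)%N ->
    {subset p m <= p m.+1} /\ ~ {subset p m.+1 <= p m}.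

Definition regular_seq (A : comPzRingType) (X : lmodType A) (s : seq A) :
    Prop :=
  (forall m, (m < size s)%N ->
     regular_elt (quotm (ideal_mul X (take m s))) s`_m) /\
  exists x : quotm (ideal_mul X s), x <> 0.

(* depth X >= n, for a local ring A: the depth of a nonzero module is the
   supremum of the lengths of the regular sequences in the maximal ideal of A,
   which consists of the nonunits; the zero module has infinite depth. *)
Definition depth_ge (A : comPzRingType) (X : lmodType A) (n : nat) : Prop :=
  (forall x : X, x = 0) \/
  exists s : seq A, [/\ size s = n,
    forall a, a \in s -> ~ exists b, a * b = 1 & regular_seq X s].

Definition cohen_macaulay (A : comPzRingType) (X : lmodType A) : Prop :=
  fin_gen X /\
  forall (p : primeIdeal A) (n : nat),
    krull_dim_ge (locr (prime_compl p)) n ->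
    depth_ge (loc (prime_compl p) X) n.

(* Main.v *)
From HB Require Import structures.
From mathcomp Require Import all_boot all_order all_algebra.
From mathcomp Require Import ring boolp.
Require Import Defs.

Set Implicit Arguments.
Unset Strict Implicit.
Unset Printing Implicit Defensive.

Import GRing.Theory.
Local Open Scope ring_scope.

(** Since [Im alpha = Ker alpha], the endomorphism [alpha + t x] of
    [L (x) k[t]] satisfies [(alpha + t x) (alpha - t x) = - t^2 x^2]: it is
    injective, and bijective up to multiples of [t^2 x^2].

    Degeneration.  Let [V] be the localization of [k[t]] at [(t)] and, inside
    [L (x) V], let [Q = (alpha + t x) (M (x) V) + x^2 (L (x) V)].
    - As [M] contains [alpha L + x L], the identity above gives
      [t^2 x^2 (L (x) V) <= (alpha + t x) (M (x) V)].  So [Q] becomes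
      isomorphic to [M (x) V_t] when [t] is inverted ([generic_fibre]).
    - Setting [t = 0] maps [Q] onto [alpha M + x^2 L = N].  An element of the
      kernel is a [t]-multiple in [Q], because [alpha m + x^2 l = 0] forces
      [l] and [m + x^2 l'], where [l = alpha l'], to lie in
      [Ker alpha = Im alpha] ([special_fibre]).
    - [Q] is torsion-free over the valuation ring [V], hence flat
      ([torsion_free_flat]).

    Cohen-Macaulayness.  Localize at a prime, and let [L] and [M] have depth at
    least [d].  Put [K = alpha L = Ker alpha] and [W = K + x^2 L].  The depth
    lemma ([grade_ge_sub], [grade_ge_ext], [grade_ge_quot]) is used for
    - [0 -> K -> L -> L / K -> 0] with [L / K = K] through [alpha], which gives
      [depth L / K >= d] by induction;
    - [0 -> M -> L -> L / M -> 0], which gives [depth L / M >= d - 1];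
    - [0 -> L / K -> L / K -> L / W -> 0], multiplication by [x^2], which gives
      [depth L / W >= d - 1];
    - [0 -> L / M -> L / N -> L / W -> 0], where the first map is induced by
      [alpha], which gives [depth L / N >= d - 1];
    - [0 -> N -> L -> L / N -> 0], which gives [depth N >= d].

    The depth lemma is proved with regular sequences only.  Two facts make this
    possible over a noetherian ring: a finitely generated module without nonzero
    element killed by the ideal [I] has a regular element in [I]
    ([exists_regular]), and the grade of
    [X / a X] is the same for all regular [a] in [I] ([grade_ge_exchange]). *)

(** * Submodules and noetherian modules *)

Section Submodules.
Variables (A : comPzRingType) (X : lmodType A).
Implicit Types (P Q Y : X -> Prop) (u v : X) (a b : A) (s : seq X).

(** Submodules are plain predicates here, since the arguments on depth build new
    submodules out of old ones at every step. *)
Definition submodule P : Prop :=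
  [/\ P 0, forall u v, P u -> P v -> P (u + v) &
      forall a u, P u -> P (a *: u)].

Lemma submodule0 P : submodule P -> P 0. Proof. by case. Qed.
Lemma submoduleD P u v : submodule P -> P u -> P v -> P (u + v).
Proof. by case=> _ h _; apply: h. Qed.
Lemma submoduleZ P a u : submodule P -> P u -> P (a *: u).
Proof. by case=> _ _; apply. Qed.
Lemma submoduleN P u : submodule P -> P u -> P (- u).
Proof. by move=> sP; rewrite -scaleN1r; apply: submoduleZ. Qed.
Lemma submoduleB P u v : submodule P -> P u -> P v -> P (u - v).
Proof. by move=> sP Pu Pv; apply: submoduleD => //; apply: submoduleN. Qed.

Definition full_mod : X -> Prop := fun=> True.
Definition zero_mod : X -> Prop := fun u => u = 0.

Lemma submodule_zero : submodule zero_mod.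
Proof.
rewrite /zero_mod.
by split=> [//|u v -> ->|a u ->]; rewrite ?addr0 ?scaler0.
Qed.

Lemma submodule_full : submodule full_mod.
Proof. by []. Qed.

Lemma zero_mod_sub P u : submodule P -> zero_mod u -> P u.
Proof. by move=> sP ->; exact: submodule0. Qed.

Lemma submodule_mem (S : submodClosed X) : submodule (fun u => u \in S).
Proof. by split=> [|u v|a u]; [exact: rpred0|exact: rpredD|exact: rpredZ]. Qed.

(** The impredicative definition makes membership in a span an induction
    principle, so that no linear combination has to be manipulated. *)
Record in_span s u : Prop := Span {
  in_span_sub : forall P, submodule P -> (forall v, v \in s -> P v) -> P u }.

Lemma submodule_in_span s : submodule (in_span s).
Proof.
split=> [|u v su sv|a u su]; split=> P sP Ps.
- exact: submodule0.
- by apply: submoduleD => //; [exact: (in_span_sub su)|exact: (in_span_sub sv)].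
- by apply: submoduleZ => //; exact: (in_span_sub su).
Qed.

Lemma mem_in_span s u : u \in s -> in_span s u.
Proof. by move=> us; split=> P _; apply. Qed.

Lemma in_span_subset s s' u : {subset s <= s'} -> in_span s u -> in_span s' u.
Proof.
move=> ss su; split=> P sP Ps; apply: (in_span_sub su) => // v /ss.
exact: Ps.
Qed.

Lemma in_span_cons u s v :
  in_span (u :: s) v -> exists a, exists2 w, in_span s w & v = a *: u + w.
Proof.
have sS := submodule_in_span s.
move/(@in_span_sub _ _)/(_ (fun v => exists a,
  exists2 w, in_span s w & v = a *: u + w)).
apply; first split.
- by exists 0, 0; [exact: submodule0|rewrite scale0r addr0].
- move=> _ _ [a [w sw ->]] [b [w' sw' ->]]; exists (a + b), (w + w').
    exact: submoduleD sS sw sw'.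
  by rewrite scalerDl addrACA.
- move=> a _ [b [w sw ->]]; exists (a * b), (a *: w).
    exact: submoduleZ sS sw.
  by rewrite scalerDr scalerA.
- move=> w; rewrite inE => /orP[/eqP->|ws].
    by exists 1, 0; [exact: submodule0|rewrite scale1r addr0].
  by exists 0, w; [exact: mem_in_span|rewrite scale0r add0r].
Qed.

Lemma submodule_comb s :
  submodule (fun u => exists a : 'I_(size s) -> A,
    u = \sum_(i < size s) a i *: s`_i).
Proof.
split=> [|_ _ [a ->] [b ->]|c _ [a ->]].
- by exists (fun=> 0); rewrite big1 // => i _; rewrite scale0r.
- exists (fun i => a i + b i); rewrite -big_split; apply: eq_bigr => i _.
  by rewrite scalerDl.
- exists (fun i => c * a i); rewrite scaler_sumr; apply: eq_bigr => i _.
  by rewrite scalerA.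
Qed.

Lemma in_spanP s u : in_span s u <->
  exists a : 'I_(size s) -> A, u = \sum_(i < size s) a i *: s`_i.
Proof.
split=> [|[a ->]].
  move/(@in_span_sub _ _)/(_ _ (submodule_comb s)); apply => v vs.
  have iv : (index v s < size s)%N by rewrite index_mem.
  exists (fun j => (j == Ordinal iv)%:R).
  rewrite (bigD1 (Ordinal iv)) //= eqxx scale1r nth_index // big1 ?addr0 //.
  by move=> j /negPf ->; rewrite scale0r.
have sS := submodule_in_span s.
elim/big_ind: _ => [|v w|j _]; [exact: submodule0|exact: submoduleD|].
by apply: submoduleZ => //; apply/mem_in_span/mem_nth.
Qed.

Definition fin_gen_sub P : Prop :=
  exists s, (forall v, v \in s -> P v) /\ forall u, P u -> in_span s u.

Definition noetherian_mod : Prop := forall P, submodule P -> fin_gen_sub P.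

Lemma fin_genP : fin_gen X <-> exists s, forall u, in_span s u.
Proof. by split=> -[s sX]; exists s => u; apply/in_spanP. Qed.

(** The ascending chain condition, as a maximality principle for families of
    submodules: a chain without maximal member would have a union that is not
    finitely generated. *)
Lemma noetherian_max (J : Type) (g : J -> X -> Prop) (j0 : J) :
  noetherian_mod -> (forall j, submodule (g j)) ->
  exists j, (forall u, g j0 u -> g j u) /\
    forall j', (forall u, g j u -> g j' u) -> forall u, g j' u -> g j u.
Proof.
move=> nX sg; apply: contrapT => nmax.
have /choice[f fP] j : exists j', (forall u, g j u -> g j' u) /\
    ((forall u, g j0 u -> g j u) -> ~ forall u, g j' u -> g j u).
  have [j0j|?] := pselect (forall u, g j0 u -> g j u); last by exists j.
  apply: contrapT => nj; apply: nmax; exists j; split=> // j' jj' u.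
  apply: contraPP => nu j'j; apply: nj; exists j'; split=> // _ h.
  by apply: nu; apply: h.
pose c n := iter n f j0.
have cS n u : g (c n) u -> g (c n.+1) u by have [h _] := fP (c n); apply: h.
have c_le m n u : (m <= n)%N -> g (c m) u -> g (c n) u.
  move/subnK <-; elim: (n - m)%N => [//|d ih] h; exact/cS/ih.
have [|s [sP Ps]] := nX (fun u => exists n, g (c n) u).
  split=> [|u v [m gu] [n gv]|a u [n gu]].
  - by exists 0%N; exact: submodule0.
  - exists (maxn m n); apply: submoduleD => //.
      exact: c_le (leq_maxl _ _) gu.
    exact: c_le (leq_maxr _ _) gv.
  - by exists n; apply: submoduleZ.
have [N NP] : exists N, forall v, v \in s -> g (c N) v.
  elim: s sP {Ps} => [|v s ih] sP; first by exists 0%N.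
  have [n gv] := sP v (mem_head _ _).
  have [N NP] := ih (fun w ws => sP w (mem_behead (s := v :: s) ws)).
  exists (maxn n N) => w; rewrite inE => /orP[/eqP->|/NP].
    exact: c_le (leq_maxl _ _) gv.
  exact: c_le (leq_maxr _ _).
have [_] := fP (c N); case=> [u|u gu]; first exact: (@c_le 0%N).
by apply: (in_span_sub (Ps u _)) => //; exists N.+1.
Qed.

(** The elements that lie in the span of a finite part of [U] form a submodule;
    each of its finitely many generators involves a finite part of [U]. *)
Lemma noetherian_span (U : X -> Prop) : noetherian_mod ->
  exists s, (forall v, v \in s -> U v) /\ forall u, U u -> in_span s u.
Proof.
move=> nX; pose P u := exists2 s, forall v, v \in s -> U v & in_span s u.
have [|s [sP Ps]] := nX P.
  split=> [|u v [s sU su] [s' sU' sv]|a u [s sU su]].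
  - by exists [::] => //; apply: submodule0; exact: submodule_in_span.
  - exists (s ++ s') => [w|]; first by rewrite mem_cat => /orP[/sU|/sU'].
    apply: submoduleD; first exact: submodule_in_span.
      by apply: in_span_subset su => w; rewrite mem_cat => ->.
    by apply: in_span_subset sv => w; rewrite mem_cat => ->; rewrite orbT.
  - by exists s => //; apply: submoduleZ => //; exact: submodule_in_span.
have [s' [s'U ss']] : exists s', (forall v, v \in s' -> U v) /\
    forall u, u \in s -> in_span s' u.
  elim: s sP {Ps} => [|v s ih] sP; first by exists [::].
  have [s1 s1U s1v] := sP v (mem_head _ _).
  have [s2 [s2U s2s]] := ih (fun w ws => sP w (mem_behead (s := v :: s) ws)).
  exists (s1 ++ s2); split=> w; first by rewrite mem_cat => /orP[/s1U|/s2U].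
  rewrite inE => /orP[/eqP->|/s2s].
    by apply: in_span_subset s1v => x; rewrite mem_cat => ->.
  by apply: in_span_subset => x; rewrite mem_cat => ->; rewrite orbT.
exists s'; split=> // u Uu; apply: (in_span_sub (Ps u _)) => //.
  by exists [:: u] => [v|]; [rewrite inE => /eqP->|apply/mem_in_span/mem_head].
exact: submodule_in_span.
Qed.

End Submodules.

Arguments noetherian_mod {A} X.
Arguments full_mod {A} X.
Arguments zero_mod {A} X.

Lemma submodule_preim (A : comPzRingType) (X X' : lmodType A) (f : X -> X')
    (P : X' -> Prop) :
  {morph f : u v / u + v} -> (forall a, {morph f : u / a *: u}) ->
  submodule P -> submodule (fun u => P (f u)).
Proof.
move=> fD fZ sP; split=> [|u v Pu Pv|a u Pu].
- by rewrite -(scale0r 0) fZ scale0r; exact: submodule0.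
- by rewrite fD; exact: submoduleD.
- by rewrite fZ; exact: submoduleZ.
Qed.

Lemma submodule_preim_linear (A : comPzRingType) (X X' : lmodType A)
    (f : {linear X -> X'}) (P : X' -> Prop) :
  submodule P -> submodule (fun u => P (f u)).
Proof. by apply: submodule_preim; [exact: linearD|exact: linearZZ]. Qed.

Lemma noetherian_surj (A : comPzRingType) (X X' : lmodType A) (f : X -> X') :
  {morph f : u v / u + v} -> (forall a, {morph f : u / a *: u}) ->
  (forall u', exists u, f u = u') -> noetherian_mod X -> noetherian_mod X'.
Proof.
move=> fD fZ f_surj nX P' sP'.
have [s [sP Ps]] := nX _ (submodule_preim fD fZ sP').
exists (map f s); split=> [_ /mapP[v /sP Pv ->] //|u'].
have [u <-] := f_surj u' => /Ps su; split=> Q sQ Qs.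
apply: (in_span_sub su (submodule_preim fD fZ sQ)) => v vs.
exact/Qs/map_f.
Qed.

(** Finite generation of an extension.  The linear relation [r] stands for a
    homomorphism from [P] to [Z] which need not be defined on all of [X]. *)
Lemma fin_gen_ext (A : comPzRingType) (X Z : lmodType A) (P : X -> Prop)
    (r : X -> Z -> Prop) :
  noetherian_mod Z -> submodule P -> r 0 0 ->
  (forall x x' z z', r x z -> r x' z' -> r (x + x') (z + z')) ->
  (forall a x z, r x z -> r (a *: x) (a *: z)) ->
  (forall x, P x -> exists z, r x z) ->
  fin_gen_sub (fun x => P x /\ r x 0) -> fin_gen_sub P.
Proof.
move=> nZ sP r0 rD rZ rP [s0 [s0P Ps0]].
have [|zs [zsI Izs]] := nZ (fun z => exists2 x, P x & r x z).
  split=> [|z z' [x Px rx] [x' Px' rx']|a z [x Px rx]].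
  - by exists 0; first exact: submodule0.
  - by exists (x + x'); [exact: submoduleD|exact: rD].
  - by exists (a *: x); [exact: submoduleZ|exact: rZ].
have /choice[h hP] z : exists x, z \in zs -> P x /\ r x z.
  have [/zsI[x Px rx]|_] := boolP (z \in zs); first by exists x.
  by exists 0.
(* lifts of generators of the image, and generators of the kernel *)
exists (s0 ++ map h zs); split=> [x|x Px].
  rewrite mem_cat => /orP[/s0P[]//|/mapP[z zzs ->]].
  by case: (hP z zzs).
have [z rxz] := rP x Px; have sS := submodule_in_span (map h zs).
pose lifts z := exists2 x', in_span (map h zs) x' /\ P x' & r x' z.
have [x' [sx' Px'] rx'z] : lifts z.
  apply: (in_span_sub (Izs z _) (P := lifts)) => [||z' z'zs]; first by exists x.
    split=> [|z1 z2 [x1 [? ?] ?] [x2 [? ?] ?]|a z1 [x1 [? ?] ?]].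
    - by exists 0 => //; split; exact: submodule0.
    - by exists (x1 + x2); [split; exact: submoduleD|exact: rD].
    - by exists (a *: x1); [split; exact: submoduleZ|exact: rZ].
  have [Ph rh] := hP z' z'zs.
  by exists (h z') => //; split=> //; apply/mem_in_span/map_f.
have -> : x = (x - x') + x' by rewrite subrK.
apply: submoduleD; first exact: submodule_in_span; last first.
  by apply: in_span_subset sx' => y; rewrite mem_cat => ->; rewrite orbT.
apply: (in_span_subset (s := s0)) => [y|]; first by rewrite mem_cat => ->.
apply: Ps0; split; first exact: submoduleB.
rewrite -(subrr z) -scaleN1r -[X in _ - X]scale1r -scaleNr.
by apply: rD => //; apply: rZ.
Qed.

(** Hilbert: split off one generator [u] and map [a u + y] to [a]; the image is
    an ideal. *)
Lemma noetherian_fin_gen (A : comPzRingType) (X : lmodType A) :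
  noetherian_mod A^o -> fin_gen X -> noetherian_mod X.
Proof.
move=> nA /fin_genP[s sX] P sP.
have {sX} : forall u, P u -> in_span s u by [].
elim: s P sP => [|u s ih] P sP Ps; first by exists [::]; split.
have sS := submodule_in_span s.
apply: (@fin_gen_ext _ _ A^o _
  (fun x a => exists2 y, in_span s y & x = (a : A) *: u + y)) => //.
- by exists 0; [exact: submodule0|rewrite scale0r addr0].
- move=> _ _ a a' [y sy ->] [y' sy' ->]; exists (y + y').
    exact: submoduleD.
  by rewrite scalerDl addrACA.
- move=> a _ b [y sy ->]; exists (a *: y); first exact: submoduleZ.
  by rewrite scalerDr scalerA.
- by move=> x /Ps/in_span_cons[a [y sy ->]]; exists a, y.
apply: ih => [|x [_ [y sy ->]]]; last by rewrite scale0r add0r.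
split=> [|x x' [Px [y sy e]] [Px' [y' sy' e']]|a x [Px [y sy e]]].
- split; first exact: submodule0.
  by exists 0; [exact: submodule0|rewrite scale0r addr0].
- split; first exact: submoduleD.
  by exists (y + y'); [exact: submoduleD|rewrite e e' !scale0r !add0r].
- split; first exact: submoduleZ.
  by exists (a *: y); [exact: submoduleZ|rewrite e !scale0r !add0r].
Qed.

Lemma submodule_slice (A : comPzRingType) (X Z : lmodType A)
    (P : X * Z -> Prop) : submodule P -> submodule (fun z => P (0, z)).
Proof.
move=> sP; split=> [|u v Pu Pv|a u Pu]; first exact: submodule0 sP.
  have -> : (0, u + v) = (0, u) + (0, v) :> X * Z by congr pair; rewrite addr0.
  exact: submoduleD.
have -> : (0, a *: u) = a *: (0, u) :> X * Z by congr pair; rewrite scaler0.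
exact: submoduleZ.
Qed.

Lemma noetherian_prod (A : comPzRingType) (X Z : lmodType A) :
  noetherian_mod X -> noetherian_mod Z -> noetherian_mod (X * Z)%type.
Proof.
move=> nX nZ P sP.
apply: (@fin_gen_ext _ _ X _ (fun x z => z = x.1)) => //.
- by move=> x x' z z' -> ->.
- by move=> a x z ->.
- by move=> x _; exists x.1.
have [s [sP' Ps]] := nZ _ (submodule_slice sP).
exists [seq (0, z) | z <- s]; split=> [_ /mapP[z zs ->]|[u1 u2] /= [Pu u0]].
  by split=> //; exact: sP'.
move: u0 Pu => <- Pu; split=> Q sQ Qs.
apply: (in_span_sub (Ps _ Pu) (submodule_slice sQ)) => v vs.
by apply: Qs; apply: map_f.
Qed.

(** * Regular elements and maximal annihilators *)

Section Regular.
Variables (A : comPzRingType) (I : A -> Prop).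

Section Subquotient.
Variable X : lmodType A.
Implicit Types (P Q Y : X -> Prop) (u v w : X) (a b c : A) (us : seq X).

(** A pair of submodules [P <= Y] stands for the module [Y / P].  All modules
    that occur in the study of depth are subquotients of a fixed one, so no
    quotient has to be formed. *)
Definition regular_mod a Y P : Prop := forall u, Y u -> P (a *: u) -> P u.

Definition socle_free Y P : Prop :=
  forall u, Y u -> (forall a, I a -> P (a *: u)) -> P u.

Definition add_smul P a Y u : Prop :=
  exists p, exists2 y, P p /\ Y y & u = p + a *: y.

Lemma submodule_add_smul P a Y :
  submodule P -> submodule Y -> submodule (add_smul P a Y).
Proof.
move=> sP sY; split=> [|_ _ [p [y [Pp Yy] ->]] [q [z [Pq Yz] ->]]
    |b _ [p [y [Pp Yy] ->]]].
- exists 0, 0; first by split; exact: submodule0.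
  by rewrite scaler0 addr0.
- exists (p + q), (y + z); first by split; exact: submoduleD.
  by rewrite scalerDr addrACA.
- exists (b *: p), (b *: y); first by split; exact: submoduleZ.
  by rewrite scalerDr !scalerA mulrC.
Qed.

Lemma add_smul_sub P a Y Z : submodule Z ->
  (forall u, P u -> Z u) -> (forall u, Y u -> Z u) ->
  forall u, add_smul P a Y u -> Z u.
Proof.
move=> sZ PZ YZ _ [p [y [/PZ Zp /YZ Zy] ->]].
by apply: submoduleD => //; apply: submoduleZ.
Qed.

Lemma add_smul_mono P Q a Y : (forall u, P u -> Q u) ->
  forall u, add_smul P a Y u -> add_smul Q a Y u.
Proof. by move=> PQ _ [p [y [/PQ Qp Yy] ->]]; exists p, y. Qed.

Lemma sub_add_smul P a Y u : submodule Y -> P u -> add_smul P a Y u.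
Proof.
move=> sY Pu; exists u, 0; last by rewrite scaler0 addr0.
by split=> //; exact: submodule0.
Qed.

Lemma smul_add_smul P a Y u : submodule P -> Y u -> add_smul P a Y (a *: u).
Proof.
by move=> sP Yu; exists 0, u; [split=> //; exact: submodule0|rewrite add0r].
Qed.

Lemma add_smulAC P a b Y :
  add_smul (add_smul P a Y) b Y = add_smul (add_smul P b Y) a Y.
Proof.
have sw c d u : add_smul (add_smul P c Y) d Y u ->
    add_smul (add_smul P d Y) c Y u.
  move=> [_ [z [[p [y [Pp Yy] ->]] Yz] ->]]; exists (p + d *: z), y.
    by split=> //; exists p, z.
  by rewrite addrAC.
by apply/funext => u; apply/propext; split; exact: sw.
Qed.

(** Over a noetherian ring the annihilators of such elements [u] are the maximal
    associated primes of [Y / P]. *)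
Definition maximal_annihilator Y P u : Prop :=
  [/\ Y u, ~ P u & forall v, Y v -> ~ P v ->
    (forall a, P (a *: u) -> P (a *: v)) -> forall a, P (a *: v) -> P (a *: u)].

(** If [a u] is nonzero then its annihilator contains that of [u], hence equals
    it. *)
Lemma maximal_annihilator_prime Y P u a b :
  submodule Y -> submodule P -> maximal_annihilator Y P u ->
  ~ P (a *: u) -> ~ P (b *: u) -> ~ P ((a * b) *: u).
Proof.
move=> sY sP [Yu nPu umax] na nb; rewrite mulrC -scalerA => Pab; apply: nb.
apply: umax Pab => //; first exact: submoduleZ.
by move=> c Pcu; rewrite scalerA mulrC -scalerA; apply: submoduleZ.
Qed.

(** A product of elements taken from the annihilators is not in the prime
    annihilator of [w]. *)
Lemma common_annihilator Y P w us : submodule Y -> submodule P ->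
  maximal_annihilator Y P w ->
  (forall v, v \in us -> exists2 c, P (c *: v) & ~ P (c *: w)) ->
  exists2 d, forall v, v \in us -> P (d *: v) & ~ P (d *: w).
Proof.
move=> sY sP wmax; have [_ nPw _] := wmax.
elim: us => [|v us ih] usP; first by exists 1; rewrite // scale1r.
have [d dus dw] := ih (fun w ws => usP w (mem_behead (s := v :: us) ws)).
have [c cv cw] := usP v (mem_head _ _).
exists (c * d); last exact: (maximal_annihilator_prime sY sP wmax cw dw).
move=> z; rewrite inE => /orP[/eqP->|/dus dz].
  by rewrite mulrC -scalerA; apply: submoduleZ.
by rewrite -scalerA; apply: submoduleZ.
Qed.

Hypothesis sI : submodule (I : A^o -> Prop).

Let ID a b : I a -> I b -> I (a + b).
Proof. exact: (submoduleD sI). Qed.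
Let IM a b : I b -> I (a * b).
Proof. exact: (submoduleZ (X := A^o) a sI). Qed.

(** Prime avoidance for the primes [Ann u]; two of them are equal as soon as
    they are comparable. *)
Lemma avoid_maximal_annihilators Y P us : submodule Y -> submodule P ->
  (forall u, u \in us -> maximal_annihilator Y P u) -> socle_free Y P ->
  exists2 a, I a & forall u, u \in us -> ~ P (a *: u).
Proof.
move=> sY sP usmax soc; elim: us usmax => [|u us ih] usmax.
  by exists 0; [exact: (submodule0 sI)|].
have [|a Ia aus] := ih.
  by move=> v vus; apply: usmax; rewrite inE vus orbT.
have umax := usmax u (mem_head _ _); have [Yu nPu _] := umax.
have [Pau|nPau] := pselect (P (a *: u)); last first.
  by exists a => // v; rewrite inE => /orP[/eqP->|/aus].
have [v vus|d dus du] := common_annihilator (us := us) sY sP umax.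
  have [Yv nPv vmax] := usmax v (mem_behead (s := u :: us) vus).
  apply: contrapT => nc; apply: (aus v vus); apply: vmax Pau => // c Pcv.
  by apply: contrapT => nPcu; apply: nc; exists c.
have [b Ib bu] : exists2 b, I b & ~ P (b *: u).
  apply: contrapT => nb; apply/nPu/soc => // b Ib.
  by apply: contrapT => nPb; apply: nb; exists b.
exists (a + b * d); first by apply: ID => //; rewrite mulrC; exact: IM.
move=> v; rewrite inE scalerDl => /orP[/eqP->|vus] Pabd.
  apply: (maximal_annihilator_prime (a := b) (b := d) sY sP umax) => //.
  by rewrite -[_ *: _](addKr (a *: u)) addrC; apply: submoduleB.
apply: (aus v vus); rewrite -[a *: v](addrK ((b * d) *: v)).
apply: submoduleB => //; rewrite -scalerA; apply: submoduleZ => //.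
exact: dus.
Qed.

Hypothesis nA : noetherian_mod A^o.

(** The zero-divisors on [Y / P] form a union of maximal annihilators, and
    finitely many of those suffice: if [u_1, ..., u_n] span all elements with
    maximal annihilator, each such annihilator contains the product of the
    [Ann u_i], hence one of them. *)
Lemma exists_regular Y P : noetherian_mod X -> submodule Y -> submodule P ->
  socle_free Y P -> exists2 a, I a & regular_mod a Y P.
Proof.
move=> nX sY sP soc.
have [us [usmax spus]] := noetherian_span (maximal_annihilator Y P) nX.
have [a Ia aus] := avoid_maximal_annihilators sY sP usmax soc.
exists a => // v Yv Pav; apply: contrapT => nPv.
pose J := {u | Y u /\ ~ P u}.
have sann (j : J) : submodule ((fun b => P (b *: sval j)) : A^o -> Prop).
  split=> [|b c Pb Pc|b c Pc]; first by rewrite scale0r; exact: submodule0.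
    by rewrite scalerDl; exact: submoduleD.
  by rewrite -[b *: c]/(b * c) -scalerA; exact: submoduleZ.
have [[w [Yw nPw]] /= [vw wmax]] :=
  noetherian_max (exist _ v (conj Yv nPv) : J) nA sann.
have Pw : maximal_annihilator Y P w.
  by split=> // z Yz nPz; exact: (wmax (exist _ z (conj Yz nPz))).
have [u uus|d dus dw] := common_annihilator (us := us) sY sP Pw; last first.
  apply: dw; apply: (in_span_sub (spus w Pw) (P := fun z => P (d *: z))) => //.
  exact: (submodule_preim_linear ( *:%R d)).
have [Yu nPu umax] := usmax u uus.
apply: contrapT => nc; apply: (aus u uus).
apply: (umax w) => //; last exact: vw.
by move=> c Pcu; apply: contrapT => nPcw; apply: nc; exists c.
Qed.

End Subquotient.

End Regular.

(** * The grade of a subquotient and the depth lemma *)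

Section Grade.
Variables (A : comPzRingType) (I : A -> Prop).

(** The recursion goes over all regular elements, where the usual definition of
    grade asks for one regular sequence, so that a regular element may be chosen
    to suit several modules at once; [grade_ge_regular] shows that one regular
    element is enough. *)
Fixpoint grade_ge (X : lmodType A) (n : nat) (Y P : X -> Prop) : Prop :=
  if n is n'.+1 then
    socle_free I Y P /\
    forall a, I a -> regular_mod a Y P -> grade_ge n' Y (add_smul P a Y)
  else True.

(** The hypotheses on [f] say that it induces an isomorphism of [Y / P] with
    [Y' / P']. *)
Lemma grade_ge_iso (X X' : lmodType A) (f : {linear X -> X'})
    (Y P : X -> Prop) (Y' P' : X' -> Prop) n :
  submodule Y -> submodule Y' -> submodule P' ->
  (forall u, Y u -> Y' (f u)) ->
  (forall u, Y u -> P u <-> P' (f u)) ->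
  (forall u', Y' u' -> exists2 u, Y u & P' (u' - f u)) ->
  grade_ge n Y P <-> grade_ge n Y' P'.
Proof.
move=> sY sY' + YY'.
elim: n P P' => [//|n ih] P P' sP' PP' surj.
have reg_iff a : regular_mod a Y P <-> regular_mod a Y' P'.
  split=> reg u Yu.
    move=> Pau; have [v Yv Puv] := surj u Yu.
    rewrite -(subrK (f v) u); apply: submoduleD => //.
    apply/PP' => //; apply: reg => //; apply/PP'; first exact: submoduleZ.
    rewrite linearZ /= -[_ *: f v](subKr (a *: u)) -scalerBr.
    by apply: submoduleB => //; apply: submoduleZ.
  move=> /(PP' _ (submoduleZ a sY Yu)); rewrite linearZ => Pau.
  by apply/PP' => //; apply: reg => //; apply: YY'.
have soc_iff : socle_free I Y P <-> socle_free I Y' P'.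
  split=> soc u Yu Iu.
    have [v Yv Puv] := surj u Yu.
    rewrite -(subrK (f v) u); apply: submoduleD => //.
    apply/PP' => //; apply: soc => // a /Iu Pau.
    apply/PP'; first exact: submoduleZ.
    rewrite linearZ /= -[_ *: f v](subKr (a *: u)) -scalerBr.
    by apply: submoduleB => //; apply: submoduleZ.
  apply/PP' => //; apply: soc => [|a /Iu]; first exact: YY'.
  by move=> /(PP' _ (submoduleZ a sY Yu)); rewrite linearZ.
have step a :
    grade_ge n Y (add_smul P a Y) <-> grade_ge n Y' (add_smul P' a Y').
  apply: ih => [|u Yu|u Yu].
  - exact: submodule_add_smul.
  - split=> [[p [y [Pp Yy] e]]|[p [y [Pp Yy] e]]].
      have Yp : Y p.
        rewrite -(addrK (a *: y) p) -e; apply: submoduleB => //.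
        exact: submoduleZ.
      exists (f p), (f y); last by rewrite e linearD linearZ.
      by split; [apply/PP'|apply: YY'].
    have [v Yv Pyv] := surj y Yy.
    exists (u - a *: v), v; last by rewrite subrK.
    split=> //; apply/PP'.
      by apply: submoduleB => //; apply: submoduleZ.
    rewrite linearB linearZ /= e -addrA -scalerBr.
    by apply: submoduleD => //; apply: submoduleZ.
  - by have [v Yv Puv] := surj u Yu; exists v => //; apply: sub_add_smul.
by split=> -[/soc_iff soc h]; split=> // a Ia /reg_iff reg; apply/step/h.
Qed.

Hypothesis sI : submodule (I : A^o -> Prop).
Hypothesis nA : noetherian_mod A^o.

Section Sequences.
Variable X : lmodType A.
Hypothesis nX : noetherian_mod X.
Implicit Types (P Q Y : X -> Prop) (u v : X) (a b c : A).

Lemma regular_socle_free a Y P : I a -> regular_mod a Y P -> socle_free I Y P.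
Proof. by move=> Ia reg u Yu Iu; apply: reg => //; apply: Iu. Qed.

(** A regular element for the product of three subquotients is regular for
    each of them. *)
Lemma exists_regular3 Y P Y' P' Y'' P'' : submodule Y -> submodule P ->
  submodule Y' -> submodule P' -> submodule Y'' -> submodule P'' ->
  socle_free I Y P -> socle_free I Y' P' -> socle_free I Y'' P'' ->
  exists2 a, I a &
    [/\ regular_mod a Y P, regular_mod a Y' P' & regular_mod a Y'' P''].
Proof.
move=> sY sP sY' sP' sY'' sP'' soc soc' soc''.
have sprod (S S' S'' : X -> Prop) :
    submodule S -> submodule S' -> submodule S'' ->
    submodule (fun w : X * (X * X) => [/\ S w.1, S' w.2.1 & S'' w.2.2]).
  move=> sS sS' sS''; split=> [|u v [? ? ?] [? ? ?]|a u [? ? ?]].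
  - by split; exact: submodule0.
  - by split; apply: submoduleD.
  - by split; apply: submoduleZ.
have [|a Ia reg] := @exists_regular _ I _ sI nA _ _
    (noetherian_prod nX (noetherian_prod nX nX))
    (sprod _ _ _ sY sY' sY'') (sprod _ _ _ sP sP' sP'').
  move=> [u [v w]] /= [Yu Yv Yw] Iuvw.
  by split; [apply: soc|apply: soc'|apply: soc''] => // a /Iuvw[].
exists a => //; split=> u Yu Pu.
- have [] // := reg (u, (0, 0)).
    by split=> //; exact: submodule0.
  by split=> //=; rewrite scaler0; exact: submodule0.
- have [] // := reg (0, (u, 0)).
    by split=> //; exact: submodule0.
  by split=> //=; rewrite scaler0; exact: submodule0.
- have [] // := reg (0, (0, u)).
    by split=> //; exact: submodule0.
  by split=> //=; rewrite scaler0; exact: submodule0.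
Qed.

(** If [a u = c v] modulo [P], then [v = a w] modulo [P] because [c] is regular
    modulo [a], and [a] can be cancelled: [u = c w]. *)
Lemma regular_add_smul a c Y P : submodule Y -> submodule P ->
  (forall u, P u -> Y u) -> regular_mod a Y P -> regular_mod c Y P ->
  regular_mod c Y (add_smul P a Y) -> regular_mod a Y (add_smul P c Y).
Proof.
move=> sY sP PY rega regc regca u Yu [p [v [Pp Yv] e]].
have [|q [w [Pq Yw] ev]] := regca v Yv.
  exists (- p), u; first by split=> //; exact: submoduleN.
  by rewrite e addKr.
exists (u - c *: w), w; last by rewrite subrK.
split=> //; apply: rega; first by apply: submoduleB => //; apply: submoduleZ.
rewrite scalerBr e ev scalerDr !scalerA [a * c]mulrC addrA addrK.
by apply: submoduleD => //; apply: submoduleZ.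
Qed.

(** Rees: the grade of [Y / (P + a Y)] is the same for all regular [a] in [I].
    An element [v] with [a u = p + b v] shows that the socles of the two
    quotients correspond to each other.  For larger [n], an element [c] regular
    on [Y / P] and on both quotients commutes with [a] and [b] in regular
    sequences, and the induction hypothesis for [Y / (P + c Y)] exchanges [a]
    with [b]. *)
Lemma grade_ge_exchange n a b Y P : submodule Y -> submodule P ->
  (forall u, P u -> Y u) -> I a -> I b ->
  regular_mod a Y P -> regular_mod b Y P ->
  grade_ge n Y (add_smul P a Y) -> grade_ge n Y (add_smul P b Y).
Proof.
elim: n a b P => [//|n ih] a b P sY sP PY Ia Ib rega regb [soca ga].
have sPa := submodule_add_smul a sP sY; have sPb := submodule_add_smul b sP sY.
have PaY u : add_smul P a Y u -> Y u by exact: add_smul_sub.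
have PbY u : add_smul P b Y u -> Y u by exact: add_smul_sub.
have socb : socle_free I Y (add_smul P b Y).
  move=> u Yu Iu; have [p [v [Pp Yv] e]] := Iu a Ia.
  have [|q [y [Pq Yy] ev]] := soca v Yv.
    move=> c Ic; have [q [w [Pq Yw] ec]] := Iu c Ic.
    exists (c *: v - a *: w), w; last by rewrite subrK.
    split=> //; apply: regb.
      by apply: submoduleB => //; apply: submoduleZ.
    have -> : b *: (c *: v - a *: w) = a *: q - c *: p.
      have -> : q = c *: u - b *: w by rewrite ec addrK.
      have -> : p = a *: u - b *: v by rewrite e addrK.
      rewrite !scalerBr !scalerA opprB [c * a]mulrC [RHS]addrC subrKA.
      by rewrite [c * b]mulrC [a * b]mulrC.
    by apply: submoduleB => //; apply: submoduleZ.
  exists (u - b *: y), y; last by rewrite subrK.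
  split=> //; apply: rega; first by apply: submoduleB => //; apply: submoduleZ.
  rewrite scalerBr e ev scalerDr !scalerA [a * b]mulrC addrA addrK.
  by apply: submoduleD => //; apply: submoduleZ.
have [c Ic [regc regca regcb]] := exists_regular3 sY sP sY sPa sY sPb
  (regular_socle_free Ia rega) soca socb.
split=> // d Id regd.
have sPc := submodule_add_smul c sP sY.
apply: (ih c d) => //; rewrite add_smulAC.
apply: (ih a b) => //.
- exact: add_smul_sub.
- exact: regular_add_smul.
- exact: regular_add_smul.
by rewrite add_smulAC; exact: ga.
Qed.

Lemma grade_ge_regular n a Y P : submodule Y -> submodule P ->
  (forall u, P u -> Y u) -> I a -> regular_mod a Y P ->
  grade_ge n Y (add_smul P a Y) -> grade_ge n.+1 Y P.
Proof.
move=> sY sP PY Ia rega ga; split; first exact: regular_socle_free rega.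
by move=> b Ib regb; apply: grade_ge_exchange ga.
Qed.

(** Second isomorphism theorem: [Q / (P + a Q)] is [(Q + a Y) / (P + a Y)] when
    [a] is regular on [Y / Q]. *)
Lemma grade_ge_add_smul n a Y Q P : submodule Y -> submodule Q ->
  submodule P -> (forall u, P u -> Q u) -> (forall u, Q u -> Y u) ->
  regular_mod a Y Q ->
  grade_ge n Q (add_smul P a Q) <->
  grade_ge n (add_smul Q a Y) (add_smul P a Y).
Proof.
move=> sY sQ sP PQ QY reg; apply: (grade_ge_iso (f := idfun)).
- by [].
- exact: submodule_add_smul.
- exact: submodule_add_smul.
- by move=> u; exact: sub_add_smul.
- move=> u Qu; split=> -[p [y [Pp Qy] e]]; exists p, y => //.
    by split=> //; exact: QY.
  split=> //; apply: reg => //.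
  by rewrite -(addKr p (_ *: _)) -e addrC; apply: submoduleB => //; apply: PQ.
- move=> _ [q [y [Qq Yy] ->]]; exists q => //=.
  by rewrite addrAC subrr add0r; exact: smul_add_smul.
Qed.

Section ShortExact.
Variables (Y Q P : X -> Prop).
Hypotheses (sY : submodule Y) (sQ : submodule Q) (sP : submodule P).
Hypotheses (PQ : forall u, P u -> Q u) (QY : forall u, Q u -> Y u).

Lemma regular_sub a : regular_mod a Y P -> regular_mod a Q P.
Proof. by move=> reg u /QY; exact: reg. Qed.

Lemma regular_extension a :
  regular_mod a Q P -> regular_mod a Y Q -> regular_mod a Y P.
Proof. by move=> reg reg' u Yu Pau; apply: reg => //; apply/reg'/PQ. Qed.
End ShortExact.

(** The depth lemma for [0 -> Q / P -> Y / P -> Y / Q -> 0] consists of this and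
    the next two statements.  In each of them an element of [I] that is regular
    on all three modules lowers every grade by one and leaves the sequence
    exact. *)
Lemma grade_ge_sub n Y Q P : submodule Y -> submodule Q ->
  submodule P -> (forall u, P u -> Q u) -> (forall u, Q u -> Y u) ->
  grade_ge n.+1 Y P -> grade_ge n Y Q -> grade_ge n.+1 Q P.
Proof.
elim: n Y Q P => [|n ih] Y Q P sY sQ sP PQ QY [soc g] gQ.
  by split=> // u /QY; exact: soc.
have [socQ _] := gQ.
have [a Ia [regP regQ _]] := exists_regular3 sY sP sY sQ sY sQ soc socQ socQ.
apply: (grade_ge_regular (a := a)) => //; first exact: regular_sub regP.
apply/(grade_ge_add_smul _ sY) => //.
have [sPa sQa] := (submodule_add_smul a sP sY, submodule_add_smul a sQ sY).
apply: (ih Y) => //.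
- exact: add_smul_mono.
- exact: add_smul_sub.
- exact: g.
- by case: gQ => _; apply.
Qed.

Lemma grade_ge_ext n Y Q P : submodule Y -> submodule Q ->
  submodule P -> (forall u, P u -> Q u) -> (forall u, Q u -> Y u) ->
  grade_ge n Q P -> grade_ge n Y Q -> grade_ge n Y P.
Proof.
elim: n Y Q P => [//|n ih] Y Q P sY sQ sP PQ QY [soc g] [soc' g'].
have [a Ia [reg reg' _]] := exists_regular3 sQ sP sY sQ sY sQ soc soc' soc'.
apply: (grade_ge_regular (a := a)) => //; first by move=> u /PQ/QY.
  exact: regular_extension reg reg'.
have [sPa sQa] := (submodule_add_smul a sP sY, submodule_add_smul a sQ sY).
apply: (ih Y (add_smul Q a Y)) => //.
- exact: add_smul_mono.
- exact: add_smul_sub.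
- by apply/(grade_ge_add_smul _ sY) => //; apply: g.
- exact: g'.
Qed.

Lemma grade_ge_quot n Y Q P : submodule Y -> submodule Q ->
  submodule P -> (forall u, P u -> Q u) -> (forall u, Q u -> Y u) ->
  grade_ge n.+1 Q P -> grade_ge n Y P -> grade_ge n Y Q.
Proof.
elim: n Y Q P => [//|n ih] Y Q P sY sQ sP PQ QY [_ g] [soc' g'].
(* A socle element [u] of [Y / Q] gives the socle element [a u] of
   [Q / (P + a Q)]. *)
have socQ : socle_free I Y Q.
  move=> u Yu Iu.
  have [a Ia [reg _ _]] := exists_regular3 sY sP sY sP sY sP soc' soc' soc'.
  have [|b Ib|p [q [Pp Qq] e]] := (g a Ia (regular_sub QY reg)).1 (a *: u).
  - exact: Iu.
  - rewrite scalerA mulrC -scalerA.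
    by apply: smul_add_smul => //; apply: Iu.
  rewrite -(subrK q u); apply: submoduleD => //; apply: PQ; apply: reg.
    by apply: submoduleB => //; exact: QY.
  by rewrite scalerBr e addrK.
have [a Ia [reg regQ _]] := exists_regular3 sY sP sY sQ sY sQ soc' socQ socQ.
apply: (grade_ge_regular (a := a)) => //.
have [sPa sQa] := (submodule_add_smul a sP sY, submodule_add_smul a sQ sY).
apply: (ih Y _ (add_smul P a Y)) => //.
- exact: add_smul_mono.
- exact: add_smul_sub.
- apply/(grade_ge_add_smul _ sY) => //; apply: g => //.
  exact: regular_sub reg.
- exact: g'.
Qed.
End Sequences.
End Grade.

Lemma grade_geW (A : comPzRingType) (I : A -> Prop) (X : lmodType A) n
    (Y P : X -> Prop) : grade_ge I n.+1 Y P -> grade_ge I n Y P.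
Proof.
elim: n Y P => [//|n ih] Y P [soc g]; split=> // a Ia reg.
by apply: ih; apply: g.
Qed.

(** * Grade and an endomorphism with equal image and kernel *)

Section SquareZero.
Variables (A : comPzRingType) (I : A -> Prop).
Hypothesis sI : submodule (I : A^o -> Prop).
Hypothesis nA : noetherian_mod A^o.
Variable X : lmodType A.
Hypothesis nX : noetherian_mod X.
Variables (alpha : {linear X -> X}) (x : A) (M N : X -> Prop).
Hypothesis im_ker : forall y, alpha y = 0 <-> exists z, y = alpha z.
Hypothesis x_reg : forall u : X, x *: u = 0 -> u = 0.
Hypotheses (sM : submodule M) (aM : forall u, M (alpha u)).
Hypothesis xM : forall u, M (x *: u).
Hypothesis N_def :
  forall u, N u <-> exists m l, M m /\ u = alpha m + x ^+ 2 *: l.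

Implicit Types u y z : X.
Let K u := alpha u = 0.
Let W := add_smul K (x ^+ 2) (full_mod X).

Lemma alpha_alpha u : alpha (alpha u) = 0.
Proof. by apply/im_ker; exists u. Qed.

Lemma x2_reg u : x ^+ 2 *: u = 0 -> u = 0.
Proof. by rewrite expr2 -scalerA => /x_reg/x_reg. Qed.

Lemma alpha_x2 u : alpha (x ^+ 2 *: u) = 0 -> alpha u = 0.
Proof. by move=> h; apply: x2_reg; rewrite -linearZ. Qed.

Lemma submodule_ker : submodule K.
Proof. exact: (submodule_preim_linear alpha (submodule_zero X)). Qed.

Lemma submodule_N : submodule N.
Proof.
split=> [|u v /N_def[m [l [Mm ->]]] /N_def[m' [l' [Mm' ->]]]|
    a u /N_def[m [l [Mm ->]]]]; apply/N_def.
- exists 0, 0; split; first exact: submodule0.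
  by rewrite linear0 scaler0 addr0.
- exists (m + m'), (l + l'); split; first exact: submoduleD.
  by rewrite linearD scalerDr addrACA.
- exists (a *: m), (a *: l); split; first exact: submoduleZ.
  by rewrite linearZ scalerDr !scalerA mulrC.
Qed.

Lemma ker_sub_M u : K u -> M u.
Proof. by move=> /im_ker[z ->]. Qed.

(** If [alpha u = alpha m + x^2 l], then [alpha l = 0], so [l = alpha z] and
    [u - m - x^2 z] is in [Ker alpha], which is contained in [M]. *)
Lemma alpha_in_N u : M u <-> N (alpha u).
Proof.
split=> [Mu|/N_def[m [l [Mm e]]]].
  by apply/N_def; exists u, 0; rewrite scaler0 addr0.
have /im_ker[z ez] : alpha l = 0.
  apply: alpha_x2; rewrite -[_ *: l](addKr (alpha m)) -e.
  by rewrite linearD linearN !alpha_alpha oppr0 addr0.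
have Mk : M (u - m - x ^+ 2 *: z).
  by apply: ker_sub_M; rewrite /K !linearB /= e linearZ -ez addrAC addrK subrr.
rewrite -(subrK (m + x ^+ 2 *: z) u) opprD (addrA u).
apply: (submoduleD sM) => //; apply: (submoduleD sM) => //.
by rewrite expr2 -scalerA.
Qed.

(** As [N] is a submodule of [X], it is enough to bound the grade of [X / N]
    from below by one less.  That quotient is an extension of
    [X / W = (X / K) / x^2 (X / K)] by [W / N = X / M]. *)
Lemma grade_ge_alpha_sq n :
  grade_ge I n (full_mod X) (zero_mod X) -> grade_ge I n M (zero_mod X) ->
  grade_ge I n N (zero_mod X).
Proof.
pose full := full_mod X; pose zero := zero_mod X.
have [[sK sf] s0] := (submodule_ker, submodule_full X, submodule_zero X).
have sN := submodule_N; have sW : submodule W by exact: submodule_add_smul.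
(* [alpha] identifies [X / K] with [K]. *)
have K_alpha m : grade_ge I m full K <-> grade_ge I m K zero.
  apply: (grade_ge_iso I (f := alpha)) => //.
    by move=> u _; exact: alpha_alpha.
  by move=> _ /im_ker[z ->]; exists z => //; rewrite subrr.
have gK m : grade_ge I m full zero -> grade_ge I m full K.
  elim: m => [//|m ih] g; apply/K_alpha.
  apply: (grade_ge_sub sI nA nX (Y := full)) => //.
    by move=> u; exact: zero_mod_sub.
  exact/ih/grade_geW.
case: n => [//|n] gX gM.
have gXM : grade_ge I n full M.
  apply: (grade_ge_quot sI nA nX (P := zero) (Q := M)) => //.
    by move=> u; exact: zero_mod_sub.
  exact: grade_geW.
(* [alpha] identifies [X / M] with [W / N]. *)
have gWN : grade_ge I n W N.
  have /(_ n) iso := @grade_ge_iso _ I _ _ alpha full M W N.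
  apply: (iso _ _ _ _ _ _).1 gXM => //.
  - by move=> u _; apply: sub_add_smul => //; exact: alpha_alpha.
  - by move=> u _; exact: alpha_in_N.
  - move=> _ [k [l [/im_ker[z ->] _] ->]]; exists z => //.
    rewrite addrAC subrr add0r; apply/N_def; exists 0, l.
    by rewrite linear0 add0r; split=> //; exact: submodule0.
(* [x ^+ 2] identifies [X / K] with [W / K]. *)
have gWK : grade_ge I n.+1 W K.
  have /(_ n.+1) iso := @grade_ge_iso _ I _ _ ( *:%R (x ^+ 2)) full K W K.
  apply: (iso _ _ _ _ _ _).1 (gK _ gX) => //.
  - by move=> u _; exact: smul_add_smul.
  - by move=> u _; split=> [Ku|]; [exact: submoduleZ|exact: alpha_x2].
  - by move=> _ [k [l [Kk _] ->]]; exists l => //; rewrite addrK.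
have gXW : grade_ge I n full W.
  apply: (grade_ge_quot sI nA nX (P := K) (Q := W)) => //.
    by move=> u; exact: sub_add_smul.
  exact/grade_geW/gK.
have NW u : N u -> W u.
  move=> /N_def[m [l [_ ->]]]; exists (alpha m), l => //; split=> //.
  exact: alpha_alpha.
apply: (grade_ge_sub sI nA nX (Y := full)) => //.
  by move=> u; exact: zero_mod_sub.
by apply: (grade_ge_ext sI nA nX (Q := W)).
Qed.
End SquareZero.

(** * Depth and grade over a local ring *)

Lemma quotm_eq0 (A : comPzRingType) (X : lmodType A) (S : submodClosed X) u :
  \pi_(quotm S)%qT u = 0 <-> u \in S.
Proof. by rewrite -[0]/(\pi_(quotm S)%qT 0) -quotmP subr0. Qed.

Lemma ideal_mulP (A : comPzRingType) (X : lmodType A) (s : seq A) u :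
  u \in ideal_mul X s <->
  exists y : nat -> X, u = \sum_(0 <= i < size s) s`_i *: y i.
Proof.
split=> [/asboolP[y ->]|[y ->]].
  exists (fun j => if insub j is Some i then y i else 0); rewrite big_mkord.
  by apply: eq_bigr => i _; rewrite valK.
by apply/asboolP; exists (fun i => y i); rewrite big_mkord.
Qed.

Lemma mem_ideal_mul1 (A : comPzRingType) (X : lmodType A) a u :
  u \in ideal_mul X [:: a] <-> exists l, u = a *: l.
Proof.
split=> [/ideal_mulP[y ->]|[l ->]].
  by exists (y 0%N); rewrite big_nat1.
by apply/ideal_mulP; exists (fun=> l); rewrite big_nat1.
Qed.

Section Depth.
Variables (A : comPzRingType) (X : lmodType A).
Implicit Types (P : X -> Prop) (u : X) (a : A) (s : seq A).

Definition nonunit a : Prop := ~ exists b, a * b = 1.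

Local Notation full := (full_mod X).
Local Notation zero := (zero_mod X).

Definition add_ideal P s := foldl (fun Q a => add_smul Q a full) P s.

Lemma ideal_mulE s :
  (fun u => u \in ideal_mul X s : Prop) = add_ideal zero s.
Proof.
apply/funext => u; apply/propext.
elim/last_ind: s u => [|s a ih] u.
  split=> [/ideal_mulP[y]|->]; first by rewrite big_nil.
  by apply/ideal_mulP; exists (fun=> 0); rewrite big_nil.
rewrite /add_ideal -cats1 foldl_cat /= -/(add_ideal _ _) cats1.
have recr (y : nat -> X) :
    \sum_(0 <= i < size (rcons s a)) (rcons s a)`_i *: y i =
    \sum_(0 <= i < size s) s`_i *: y i + a *: y (size s).
  rewrite size_rcons big_nat_recr //= nth_rcons ltnn eqxx; congr (_ + _).
  by apply: eq_big_nat => j /= js; rewrite nth_rcons js.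
split=> [/ideal_mulP[y ->]|[p [v [/ih/ideal_mulP[y ->] _] ->]]].
  rewrite recr; exists (\sum_(0 <= j < size s) s`_j *: y j), (y (size s)) => //.
  by split=> //; apply/ih/ideal_mulP; exists y.
apply/ideal_mulP; exists (fun j => if (j < size s)%N then y j else v).
rewrite recr ltnn; congr (_ + _).
by apply: eq_big_nat => j /= js; rewrite js.
Qed.

Lemma regular_elt_quotm s a :
  regular_elt (quotm (ideal_mul X s)) a <->
  regular_mod a full (add_ideal zero s).
Proof.
rewrite -ideal_mulE; split=> [reg u _ au|reg z].
  apply/quotm_eq0; apply: reg.
  by rewrite -[LHS]/(quotm_scale _ _) quotm_scaleE; apply/quotm_eq0.
have [{}z ->] := quotm_surj z.
rewrite -[_ *: _]/(quotm_scale _ _) quotm_scaleE => /quotm_eq0 az.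
by apply/quotm_eq0; apply: reg.
Qed.

Hypothesis local : submodule (nonunit : A^o -> Prop).
Hypothesis nA : noetherian_mod A^o.
Hypothesis nX : noetherian_mod X.

(** A form of Nakayama's lemma.  If [X = P + a X] then
    [P + A u] with [u] outside [P] can always be enlarged: [u] is [a v] modulo
    [P]; and if [v] is [r u] modulo [P], the unit [1 - a r] sends [u] to [P]. *)
Lemma nakayama a P : submodule P -> nonunit a -> (exists u, ~ P u) ->
  exists u, ~ add_smul P a full u.
Proof.
move=> sP Ia [u0 nPu0]; apply: contrapT => allP.
pose J := {u | ~ P u}.
pose g (j : J) v := exists p, exists2 r : A, P p & v = p + r *: sval j.
have sg j : submodule (g j).
  split=> [|_ _ [p [r Pp ->]] [q [t Pq ->]]|b _ [p [r Pp ->]]].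
  - by exists 0, 0; [exact: submodule0|rewrite scale0r addr0].
  - exists (p + q), (r + t); first exact: submoduleD.
    by rewrite scalerDl addrACA.
  - exists (b *: p), (b * r); first exact: submoduleZ.
    by rewrite scalerDr scalerA.
have gself j : g j (sval j).
  by exists 0, 1; [exact: submodule0|rewrite scale1r add0r].
have [[u nPu] [_ umax]] := noetherian_max (exist _ u0 nPu0 : J) nX sg.
have [p [v [Pp _] eu]] : add_smul P a full u.
  by apply: contrapT => nu; apply: allP; exists u.
have nPv : ~ P v.
  move=> Pv; apply: (nPu); rewrite eu; apply: submoduleD => //.
  exact: submoduleZ.
have [|q [r Pq ev]] := umax (exist _ v nPv) _ v (gself (exist _ v nPv)).
  move=> _ [q [r Pq ->]]; exists (q + r *: p), (r * a) => /=.
    by apply: submoduleD => //; apply: submoduleZ.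
  by rewrite eu scalerDr scalerA addrA.
have [b eb] : exists b, (1 - a * r) * b = 1.
  apply: contrapT => I1.
  have : nonunit (1 - a * r + r * a).
    by apply: (submoduleD local) => //; exact: (submoduleZ (X := A^o) r local).
  by rewrite mulrC subrK; apply; exists 1; rewrite mulr1.
apply: (nPu); rewrite -[u]scale1r -eb mulrC -scalerA; apply: submoduleZ => //.
rewrite scalerBl scale1r {1}eu ev /= scalerDr scalerA addrA addrK.
by apply: submoduleD => //; apply: submoduleZ.
Qed.

Lemma grade_ge_total n P : (forall u, P u) -> grade_ge nonunit n full P.
Proof.
elim: n P => [//|n ih] P allP; split=> // a Ia _; apply: ih => u.
by apply: sub_add_smul.
Qed.

Lemma regular_seq_grade s P : submodule P ->
  (forall a, a \in s -> nonunit a) ->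
  (forall m, (m < size s)%N ->
     regular_mod s`_m full (add_ideal P (take m s))) ->
  grade_ge nonunit (size s) full P.
Proof.
elim: s P => [//|a s ih] P sP Is reg.
have Ia : nonunit a by apply: Is; exact: mem_head.
apply: (grade_ge_regular local nA nX (a := a)) => //; first exact: (reg 0%N).
apply: ih => [|b bs|m ms].
- exact: submodule_add_smul.
- by apply: Is; rewrite inE bs orbT.
- exact: (reg m.+1).
Qed.

Lemma grade_regular_seq n P : submodule P -> (exists u, ~ P u) ->
  grade_ge nonunit n full P -> exists s, [/\ size s = n,
    forall a, a \in s -> nonunit a,
    forall m, (m < size s)%N ->
     regular_mod s`_m full (add_ideal P (take m s)) &
    exists u, ~ add_ideal P s u].
Proof.
elim: n P => [|n ih] P sP PX; first by exists [::].
move=> [soc g].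
have [a Ia reg] := exists_regular local nA nX (submodule_full X) sP soc.
have [||s [ss Is regs sX]] := ih _ _ _ (g a Ia reg).
- exact: submodule_add_smul.
- exact: nakayama.
exists (a :: s); split=> [|b|[|m] //|//]; first by rewrite /= ss.
- by rewrite inE => /orP[/eqP->|/Is].
- exact: regs.
Qed.

(** From left to right, [grade_ge_regular] is applied along the sequence.  From
    right to left, [exists_regular] supplies the members of a sequence, and
    Nakayama's lemma keeps the quotient nonzero. *)
Lemma depth_geP n : depth_ge X n <-> grade_ge nonunit n full zero.
Proof.
have s0 := submodule_zero X; split=> [[X0|[s [<- Is [reg _]]]]|g].
- exact: grade_ge_total.
- by apply: regular_seq_grade => // m ms; apply/regular_elt_quotm/reg.
have [X0|nX0] := pselect (forall u : X, u = 0); [by left|right].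
have [|s [ss Is reg [u nu]]] := grade_regular_seq s0 _ g.
  apply: contrapT => h; apply: nX0 => u; apply: contrapT => nu.
  by apply: h; exists u.
exists s; split=> //; split=> [m ms|]; first by apply/regular_elt_quotm/reg.
exists (\pi_(quotm (ideal_mul X s))%qT u) => /quotm_eq0.
by rewrite -ideal_mulE in nu.
Qed.

End Depth.
Arguments nonunit {A} a.

(** * Localization of modules *)

Section Localization.
Variables (A : comPzRingType) (S : mulrClosed A).

Section Fractions.
Variable X : lmodType A.
Implicit Types (x : X) (s : denom S).

Lemma frac_eq0 x s : frac x s = 0 <-> exists2 u, u \in S & u *: x = 0.
Proof.
rewrite -[0]/(frac 0 (denom1 S)); split=> [/fracP[u Su]|[u Su e]].
  by rewrite /= scale1r !scaler0; exists u.
by apply/fracP; exists u; rewrite //= scale1r !scaler0.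
Qed.

Lemma to_loc_frac a x s : to_loc S a *: frac x s = frac (a *: x) s.
Proof. by rewrite fracZ; apply: frac_eq; rewrite /= mul1r. Qed.

Lemma frac_addl x y s : frac (x + y) s = frac x s + frac y s.
Proof.
rewrite fracD; apply: frac_eq.
by rewrite /= !scalerDr !scalerA.
Qed.

Lemma frac_expand (u : denom S) x s :
  frac (sval u *: x) (denomM u s) = frac x s.
Proof. by apply: frac_eq; rewrite /= !scalerA mulrC. Qed.

Definition loc_sub (P : X -> Prop) (z : loc S X) : Prop :=
  exists x, exists2 s, P x & z = frac x s.

Lemma submodule_loc_sub P : submodule P -> submodule (loc_sub P).
Proof.
move=> sP; split=> [|_ _ [x [s Px ->]] [y [t Py ->]]|a _ [x [s Px ->]]].
- by exists 0, (denom1 S); first exact: submodule0.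
- rewrite fracD; exists (sval t *: x + sval s *: y), (denomM s t) => //.
  by apply: submoduleD => //; apply: submoduleZ.
have [{}a [t ->]] := fracr_surj a; rewrite fracZ.
by exists (a *: x), (denomM t s) => //; apply: submoduleZ.
Qed.

Lemma noetherian_loc : noetherian_mod X -> noetherian_mod (loc S X).
Proof.
move=> nX P sP; have [|s [sP' Ps]] := nX (fun x => P (frac x (denom1 S))).
  split=> [|x y Px Py|a x Px].
  - exact: (submodule0 sP).
  - by rewrite frac_addl; exact: submoduleD.
  - by rewrite -to_loc_frac; exact: submoduleZ.
exists [seq frac x (denom1 S) | x <- s]; split=> [_ /mapP[x /sP' Px ->] //|z].
have [x [t ->]] := frac_surj z => Pxt.
have fracE : frac x t = fracr 1 t *: frac x (denom1 S).
  by rewrite fracZ; apply: frac_eq; rewrite /= scale1r mulr1.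
have /Ps/in_span_sub Px : P (frac x (denom1 S)).
  have -> : frac x (denom1 S) = to_loc S (sval t) *: frac x t.
    by rewrite to_loc_frac; apply: frac_eq; rewrite /= scale1r.
  exact: submoduleZ.
have sS := submodule_in_span [seq frac x (denom1 S) | x <- s].
rewrite fracE; apply: submoduleZ => //.
apply: (Px (fun x => in_span _ (frac x (denom1 S)))) => [|y ys]; last first.
  by apply/mem_in_span/map_f.
split=> [|y y' sy sy'|a y sy].
- exact: (submodule0 sS).
- by rewrite frac_addl; exact: submoduleD.
- by rewrite -to_loc_frac; exact: submoduleZ.
Qed.

End Fractions.

Section LocMap.
Variables (X Y : lmodType A) (f : {linear X -> Y}).

Definition loc_map : loc S X -> loc S Y :=
  locked (fun z => frac (f (repr z).1) (repr z).2).

Lemma loc_mapE x s : loc_map (frac x s) = frac (f x) s.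
Proof.
rewrite /loc_map -lock; have /fracP[u Su e] := fracK (frac x s).
by apply/fracP; exists u => //; have := congr1 f e; rewrite !(linearZ_LR f).
Qed.

Lemma loc_map_linear : linear loc_map.
Proof.
move=> a x y; have [{}a [s ->]] := fracr_surj a.
have [{}x [t ->]] := frac_surj x; have [{}y [u ->]] := frac_surj y.
rewrite fracZ fracD !loc_mapE fracZ fracD.
by rewrite (linearD f) !(linearZ_LR f).
Qed.
HB.instance Definition _ :=
  GRing.isLinear.Build (locr S) (loc S X) (loc S Y) *:%R loc_map loc_map_linear.

End LocMap.

Lemma grade_ge_loc_submod I n (X : lmodType A) (P : submodClosed X) :
  grade_ge I n (full_mod (loc S (submod P))) (zero_mod _) <->
  grade_ge I n (loc_sub (fun x : X => x \in P)) (zero_mod (loc S X)).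
Proof.
apply: (grade_ge_iso I (f := loc_map val)) => //.
- exact/submodule_loc_sub/submodule_mem.
- exact: submodule_zero.
- move=> z _; have [x [s ->]] := frac_surj z.
  by exists (val x), s; [exact: valP|rewrite /= loc_mapE].
- move=> z _; have [x [s ->]] := frac_surj z; rewrite /= loc_mapE.
  split=> /frac_eq0[u Su e]; apply/frac_eq0; exists u => //.
    by have := congr1 val e; rewrite (linearZ_LR val).
  by apply: val_inj; rewrite (linearZ_LR val) e raddf0.
- move=> _ [x [s Px ->]]; exists (frac (Submod Px) s) => //.
  by rewrite /= loc_mapE subrr.
Qed.

End Localization.

Section LocalRing.
Variables (A : comPzRingType) (p : primeIdeal A).

Lemma nonunit_locr (z : locr (prime_compl p)) :
  nonunit z <-> loc_sub (fun a : A^o => a \in (p : {pred A^o})) z.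
Proof.
split=> [nz|[a [s pa ->]] [w]].
  have [a [s ez]] := fracr_surj z; exists a, s => //.
  apply: contrapT => /negP na; apply: nz.
  exists (fracr (sval s) (exist _ (a : A) na : denom (prime_compl p))).
  by rewrite ez fracrM; apply: fracr_eq; rewrite /= mul1r mulr1 mulrC.
have [{}w [t ->]] := fracr_surj w.
rewrite -[X in X * _]/(fracr (a : A) s) fracrM.
case/fracP => u Su /=; rewrite -![_ *: _]/(_ * _) mul1r mulr1 => e.
have : u * (sval s * sval t) \in (p : {pred A^o}).
  by rewrite -e mulrCA mulrC; exact: (@rpredZ A A^o p (u * w) _ pa).
by move=> /primeM[|/primeM[]] ?;
  [move: Su|move: (valP s)|move: (valP t)] => /negP.
Qed.

Lemma submodule_nonunit_locr :
  submodule (nonunit : (locr (prime_compl p))^o -> Prop).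
Proof.
have -> : @nonunit (locr (prime_compl p)) =
    loc_sub (fun a : A^o => a \in (p : {pred A^o})).
  by apply/funext => z; apply/propext; exact: nonunit_locr.
have := @submodule_loc_sub A (prime_compl p) A^o _ (@submodule_mem A A^o p).
by apply.
Qed.

Lemma noetherian_locr :
  noetherian_mod A^o -> noetherian_mod (locr (prime_compl p))^o.
Proof.
(* The localized ring carries two module structures over itself, with the same
   operations but different proofs of the axioms. *)
move/(@noetherian_loc A (prime_compl p) A^o).
apply: (@noetherian_surj (locr (prime_compl p)) _ (locr (prime_compl p))^o
  (fun z : loc (prime_compl p) A^o => z : (locr (prime_compl p))^o)) => //.
by move=> u; exists u.
Qed.

End LocalRing.

(** * Cohen-Macaulay modules *)

Section SubmodFinGen.
Variables (A : comPzRingType) (X : lmodType A).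

Lemma fin_gen_submod (S : submodClosed X) :
  fin_gen_sub (fun u => u \in S) <-> fin_gen (submod S).
Proof.
split=> [[s [sS Ss]]|/fin_genP[s sS]]; last first.
  exists [seq val v | v <- s].
  split=> [_ /mapP[v _ ->]|u Su]; first exact: valP.
  split=> Q sQ Qs.
  apply: (in_span_sub (sS (Submod Su)) (P := fun v => Q (val v))) => [|v vs].
    exact: (submodule_preim_linear (val : {linear submod S -> X})).
  exact/Qs/map_f.
apply/fin_genP; exists [seq insubd 0 v | v <- s] => u; split=> Q sQ Qs.
pose Q' x := exists2 v : submod S, Q v & val v = x.
have [||v Qv /val_inj <- //] := in_span_sub (Ss _ (valP u)) (P := Q').
  split=> [|_ _ [v Qv <-] [w Qw <-]|a _ [v Qv <-]].
  - by exists 0; first exact: submodule0.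
  - by exists (v + w); first exact: submoduleD.
  - by exists (a *: v); first exact: submoduleZ.
move=> v vs; exists (insubd 0 v); first exact/Qs/map_f.
by rewrite insubdK //; exact: sS.
Qed.

(** The proof is an argument so that the structure of closed predicate can be
    inferred. *)
Definition pred_of_submodule P of submodule P : {pred X} := fun x => `[<P x>].

Variables (P : X -> Prop) (sP : submodule P).

Lemma pred_of_submodule_closed : subsemimod_closed (pred_of_submodule sP).
Proof.
split; [split; [|move=> u v]|move=> a u]; rewrite !unfold_in.
- by apply/asboolP; exact: submodule0.
- by move=> /asboolP Pu /asboolP Pv; apply/asboolP; exact: submoduleD.
- by move=> /asboolP Pu; apply/asboolP; exact: submoduleZ.
Qed.
HB.instance Definition _ := GRing.isSubSemiModClosed.Build A X
  (pred_of_submodule sP) pred_of_submodule_closed.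

Lemma mem_pred_of_submodule : (fun x => x \in pred_of_submodule sP : Prop) = P.
Proof.
by apply/funext => x; apply/propext; rewrite unfold_in; split=> /asboolP.
Qed.

End SubmodFinGen.

Lemma noetherian_noetherian_mod (A : comPzRingType) :
  noetherian A -> noetherian_mod A^o.
Proof.
move=> nA P sP; rewrite -(mem_pred_of_submodule sP).
exact/fin_gen_submod/nA.
Qed.

Lemma depth_ge_loc (R : comPzRingType) (X : lmodType R) (p : primeIdeal R) n :
  noetherian_mod R^o -> noetherian_mod X ->
  depth_ge (loc (prime_compl p) X) n <->
  grade_ge nonunit n (full_mod _) (zero_mod (loc (prime_compl p) X)).
Proof.
move=> nR nX; apply: depth_geP; first exact: submodule_nonunit_locr.
  exact: noetherian_locr.
exact: noetherian_loc.
Qed.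

Lemma depth_ge_loc_submod (R : comPzRingType) (X : lmodType R)
    (S : submodClosed X) (p : primeIdeal R) n :
  noetherian_mod R^o -> noetherian_mod X ->
  depth_ge (loc (prime_compl p) (submod S)) n <->
  grade_ge nonunit n (loc_sub (fun u : X => u \in S))
    (zero_mod (loc (prime_compl p) X)).
Proof.
move=> nR nX; apply: iff_trans (grade_ge_loc_submod _ _ _).
apply: depth_ge_loc => //; apply: noetherian_fin_gen => //.
by apply/fin_gen_submod/nX/submodule_mem.
Qed.

Section CohenMacaulay.
Variables (R : comPzRingType) (L : lmodType R) (alpha : {linear L -> L}).
Variables (x : R) (M : submodClosed L).
Hypotheses (nR : noetherian_mod R^o) (nL : noetherian_mod L).
Hypothesis im_ker : im_sub alpha (full_sub L) =i [pred y : L | alpha y == 0].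
Hypothesis x_reg : regular_elt L x.
Hypothesis M_sub :
  {subset add_sub (im_sub alpha (full_sub L)) (ideal_mul L [:: x]) <= M}.

Lemma im_kerP y : alpha y = 0 <-> exists z, y = alpha z.
Proof.
split=> [/eqP ay|[z ->]].
  have : y \in im_sub alpha (full_sub L) by rewrite im_ker.
  by move=> /asboolP[z _ ->]; exists z.
by apply/eqP; rewrite -[_ == 0]im_ker; apply/asboolP; exists z.
Qed.

Lemma alpha_mem u : alpha u \in M.
Proof.
apply: M_sub; apply/asboolP; exists (alpha u), 0; rewrite rpred0 addr0.
by split=> //; apply/asboolP; exists u.
Qed.

Lemma x_mem u : x *: u \in M.
Proof.
apply: M_sub; apply/asboolP; exists 0, (x *: u); rewrite rpred0 add0r.
by split=> //; apply/mem_ideal_mul1; exists u.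
Qed.

Lemma mem_N u : u \in add_sub (im_sub alpha M) (ideal_mul L [:: x ^+ 2]) <->
  exists m l, m \in M /\ u = alpha m + x ^+ 2 *: l.
Proof.
split=> [/asboolP[_ [_ [/asboolP[m Mm ->] /mem_ideal_mul1[l ->] ->]]]|].
  by exists m, l.
move=> [m [l [Mm ->]]]; apply/asboolP; exists (alpha m), (x ^+ 2 *: l).
by split=> //; [apply/asboolP; exists m|apply/mem_ideal_mul1; exists l].
Qed.

(** All hypotheses on [alpha], [x], [M] and [N] pass to the localization at a
    prime, where [grade_ge_alpha_sq] applies. *)
Lemma cohen_macaulay_alpha_sq : cohen_macaulay L -> cohen_macaulay (submod M) ->
  cohen_macaulay
    (submod (add_sub (im_sub alpha M) (ideal_mul L [:: x ^+ 2]))).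
Proof.
move=> [_ cmL] [_ cmM]; split; first by apply/fin_gen_submod/nL/submodule_mem.
move=> p n dim; have {cmL} := cmL p n dim; have {cmM} := cmM p n dim.
move=> /depth_ge_loc_submod-/(_ nR nL) gM /depth_ge_loc-/(_ nR nL) gL.
apply/depth_ge_loc_submod => //; set S := prime_compl p in gM gL *.
apply: (@grade_ge_alpha_sq _ _ (submodule_nonunit_locr p) (noetherian_locr nR)
  _ (noetherian_loc nL) (loc_map alpha) (to_loc S x) _ _ _ _ _ _ _ _ n gL gM).
- move=> z; have [l [s ->]] := frac_surj z; rewrite /= loc_mapE; split.
    move=> /frac_eq0[u Su]; rewrite -(linearZ_LR alpha) => /im_kerP[l' el].
    exists (frac l' (denomM (exist _ u Su) s)).
    by rewrite loc_mapE -el -(frac_expand (exist _ u Su)).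
  move=> [w]; have [l' [t ->]] := frac_surj w; rewrite loc_mapE.
  move=> /fracP[u Su e]; apply/frac_eq0; exists (u * sval t).
    by rewrite rpredM //; exact: (valP t).
  rewrite -scalerA -!(linearZ_LR alpha) e !(linearZ_LR alpha).
  by rewrite (im_kerP _).2 ?scaler0 //; exists l'.
- move=> z; have [l [s ->]] := frac_surj z; rewrite to_loc_frac.
  move=> /frac_eq0[u Su e]; apply/frac_eq0; exists u => //; apply: x_reg.
  by rewrite scalerA mulrC -scalerA.
- exact/submodule_loc_sub/submodule_mem.
- move=> z; have [l [s ->]] := frac_surj z; rewrite /= loc_mapE.
  by exists (alpha l), s => //; exact: alpha_mem.
- move=> z; have [l [s ->]] := frac_surj z; rewrite to_loc_frac.
  by exists (x *: l), s => //; exact: x_mem.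
move=> z; split=> [[_ [s /mem_N[m [l [Mm ->]]] ->]]|].
  exists (frac m s), (frac l s); split; first by exists m, s.
  by rewrite /= loc_mapE -rmorphXn to_loc_frac frac_addl.
move=> [_ [w [[m [s Mm ->]] ->]]]; have [l [t ->]] := frac_surj w.
rewrite /= loc_mapE -rmorphXn to_loc_frac fracD.
exists (sval t *: alpha m + sval s *: (x ^+ 2 *: l)), (denomM s t) => //.
apply/mem_N; exists (sval t *: m), (sval s *: l); split; first exact: rpredZ.
by rewrite (linearZ_LR alpha) !scalerA [x ^+ 2 * _]mulrC.
Qed.
End CohenMacaulay.

(** * Flatness over valuation rings *)

Definition valuation_ring (A : comPzRingType) : Prop :=
  forall a b : A, (exists c, b = c * a) \/ (exists c, a = c * b).

Definition torsion_free (A : comPzRingType) (Y : lmodType A) : Prop :=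
  forall (a : A) (y : Y), a *: y = 0 -> a = 0 \/ y = 0.

Section FreeCover.
Variables (A : comPzRingType) (Y : lmodType A).

Definition free_family (s : seq Y) : Prop := forall a : 'I_(size s) -> A,
  \sum_(i < size s) a i *: s`_i = 0 -> forall i, a i = 0.

Hypotheses (valA : valuation_ring A) (tfY : torsion_free Y).

Lemma valuation_min (b : A) r :
  exists2 c, c \in b :: r & forall d, d \in b :: r -> exists e, d = e * c.
Proof.
elim: r b => [|b' r ih] b.
  exists b => [|d]; first exact: mem_head.
  by rewrite inE => /eqP->; exists 1; rewrite mul1r.
have [c cr cmin] := ih b'; have [[e ec]|[e eb]] := valA b c.
  exists b => [|d]; first exact: mem_head.
  rewrite inE => /orP[/eqP->|/cmin[f ->]]; first by exists 1; rewrite mul1r.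
  by exists (f * e); rewrite ec mulrA.
exists c => [|d]; first by rewrite inE cr orbT.
by rewrite inE => /orP[/eqP->|/cmin //]; exists e.
Qed.

(** Over a valuation ring a spanning family of minimal length in a torsion-free
    module is free: in a nontrivial relation one coefficient divides all others,
    and dividing by it expresses one member by the others. *)
Lemma free_cover (W : seq Y) :
  exists2 s, forall w, w \in W -> in_span s w & free_family s.
Proof.
pose covers n :=
  `[< exists2 s, size s = n & forall w, w \in W -> in_span s w >].
have exn : exists n, covers n.
  by exists (size W); apply/asboolP; exists W => // w; exact: mem_in_span.
have [_ /asboolP[s <- sW] smin] := ex_minnP exn; exists s => // a a0.
apply: contrapT => /existsNP[i0 ai0].
have i0a : a i0 \in codom a by exact: codom_f.
have [c ca cmin] : exists2 c, c \in codom a &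
    forall d, d \in codom a -> exists e, d = e * c.
  by case: (codom a) i0a => // b r _; exact: valuation_min.
have [i _ ei] := imageP ca; have c0 : c <> 0.
  by move=> c0; have [e ea] := cmin _ i0a; apply: ai0; rewrite ea c0 mulr0.
have /choice[e ea] j : exists e, a j = e * c by apply/cmin/codom_f.
pose s' := take i s ++ drop i.+1 s; have ss' := submodule_in_span s'.
have s'j (j : 'I_(size s)) : j != i -> in_span s' s`_j.
  move=> ji; apply: mem_in_span; rewrite mem_cat.
  have [lji|lij] := ltnP j i.
    by rewrite -(nth_take 0 lji) mem_nth // size_take ltn_ord.
  have {lij} lij : (i < j)%N by rewrite ltn_neqAle eq_sym ji lij.
  have -> : s`_j = (drop i.+1 s)`_(j - i.+1) by rewrite nth_drop subnKC.
  rewrite orbC mem_nth // size_drop.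
  by rewrite ltn_sub2r // (leq_trans _ (ltn_ord j)).
have s'i : in_span s' s`_i.
  have [|//|e0] := tfY (a := c) (y := s`_i + \sum_(j | j != i) e j *: s`_j).
    rewrite scalerDr -[RHS]a0 [RHS](bigD1 i) //= -ei scaler_sumr; congr (_ + _).
    by apply: eq_bigr => j _; rewrite scalerA mulrC -ea.
  rewrite -[s`_i](addrK (\sum_(j | j != i) e j *: s`_j)) e0 sub0r.
  apply: submoduleN => //; apply: (big_ind (in_span s')) => [|u v|j /s'j].
  - exact: (submodule0 ss').
  - exact: submoduleD.
  - exact: submoduleZ.
have : covers (size s').
  apply/asboolP; exists s' => // w /sW sw.
  apply: (in_span_sub sw) => // v /(nthP 0)[j js <-].
  have [ji|ji] := eqVneq (Ordinal js) i; first by move: s'i; rewrite -ji.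
  exact: (s'j (Ordinal js)).
move=> /smin; rewrite size_cat size_take size_drop ltn_ord.
by rewrite -{1}(subnKC (ltn_ord i)) addSn leqNgt ltnS leqnn.
Qed.
End FreeCover.

Section Coordinates.
Variables (A : comPzRingType) (X Y : lmodType A).

(** A derivation of an equality of tensors involves finitely many elements of
    [Y]; a linear form [c] defined on a submodule that contains them can be
    evaluated along the derivation. *)
Lemma tens_eq_form (s t : seq (X * Y)) : tens_eq s t -> exists W : seq Y,
  forall (Z : Y -> Prop) (c : Y -> A), (forall w, w \in W -> Z w) ->
  (forall y y', Z y -> Z y' -> c (y + y') = c y + c y') ->
  (forall a y, Z y -> c (a *: y) = a * c y) ->
  \sum_(p <- s) c p.2 *: p.1 = \sum_(p <- t) c p.2 *: p.1.
Proof.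
elim=> {s t}.
- by exists [::].
- by move=> s t _ [W h]; exists W => Z c WZ cD cZ; rewrite (h Z).
- move=> s t u _ [W h] _ [W' h']; exists (W ++ W') => Z c WZ cD cZ.
  rewrite (h Z) // => [|w wW]; last by apply: WZ; rewrite mem_cat wW.
  by rewrite (h' Z) // => w wW; apply: WZ; rewrite mem_cat wW orbT.
- move=> s s' t t' _ [W h] _ [W' h']; exists (W ++ W') => Z c WZ cD cZ.
  rewrite !big_cat /= (h Z) // => [|w wW]; last first.
    by apply: WZ; rewrite mem_cat wW.
  by rewrite (h' Z) // => w wW; apply: WZ; rewrite mem_cat wW orbT.
- by move=> s t; exists [::] => Z c _ _ _; rewrite !big_cat /= addrC.
- move=> x x' y; exists [::] => Z c _ _ _.
  by rewrite !big_cons !big_nil /= scalerDr !addr0.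
- move=> x y y'; exists [:: y; y'] => Z c WZ cD _.
  rewrite !big_cons !big_nil /= cD ?scalerDl ?addr0 //.
    exact/WZ/mem_head.
  by apply: WZ; rewrite !inE eqxx orbT.
- move=> a x y; exists [:: y] => Z c WZ _ cZ.
  rewrite !big_cons !big_nil /= cZ; last exact/WZ/mem_head.
  by rewrite scalerA mulrC.
- move=> y; exists [::] => Z c _ _ _.
  by rewrite big_cons !big_nil /= scaler0 addr0.
Qed.

Lemma tens0r (x : X) : tens x (0 : Y) = 0.
Proof. by apply: (addrI (tens x 0)); rewrite -tensDr !addr0. Qed.

Lemma tens_suml (J : Type) (r : seq J) (F : J -> X) (y : Y) :
  tens (\sum_(j <- r) F j) y = \sum_(j <- r) tens (F j) y.
Proof. exact: (big_morph (fun x => tens x y) (tensDl y) (tens0l _ y)). Qed.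

Lemma tens_sumr (J : Type) (r : seq J) (x : X) (F : J -> Y) :
  tens x (\sum_(j <- r) F j) = \sum_(j <- r) tens x (F j).
Proof. exact: (big_morph _ (tensDr x) (tens0r x)). Qed.
End Coordinates.

(** A relation among images of tensors can be read off in the coordinates of a
    free family whose span contains all the elements of [Y] involved, and [f] is
    cancelled in each coordinate. *)
Lemma tens_mapl_inj (A : comPzRingType) (X X' Y : lmodType A)
    (f : {linear X -> X'}) : valuation_ring A -> torsion_free Y ->
  injective f -> injective (tens_mapl f : tensor X Y -> tensor X' Y).
Proof.
move=> valA tfY f_inj.
have fB := tens_mapl_balanced Y f.
suff ker0 z : tens_mapl f z = 0 :> tensor X' Y -> z = 0.
  move=> z w e; apply/eqP; rewrite -subr_eq0; apply/eqP/ker0.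
  apply: (addIr (tens_mapl f w)); rewrite add0r -{2}e.
  by rewrite -(tens_liftD fB) subrK.
have [l ->] := tens_surj z; rewrite /tens_mapl (tens_lift_cls fB) => e.
have {}e : tens_cls [seq (f p.1, p.2) | p <- l] = tens_cls [::].
  by rewrite !tens_clsE big_map big_nil.
have [W eW] := tens_eq_form ((tens_clsP _ _).1 e).
have [s sW s_free] := free_cover valA tfY (W ++ map snd l).
have /choice[c cE] y : exists a : 'I_(size s) -> A,
    in_span s y -> y = \sum_(i < size s) a i *: s`_i.
  have [/in_spanP[a ea]|ny] := pselect (in_span s y); first by exists a.
  by exists (fun=> 0).
have ss := submodule_in_span s.
have c_uniq y (a : 'I_(size s) -> A) i :
    in_span s y -> y = \sum_(i < size s) a i *: s`_i -> c y i = a i.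
  move=> sy ey; apply/eqP; rewrite -subr_eq0; apply/eqP.
  apply: (s_free (fun i => c y i - a i)).
  under eq_bigr do rewrite scalerBl.
  by rewrite sumrB -ey -cE ?subrr.
have cD i y y' : in_span s y -> in_span s y' -> c (y + y') i = c y i + c y' i.
  move=> sy sy'; apply: (c_uniq _ (fun i => c y i + c y' i)).
    exact: submoduleD.
  under eq_bigr do rewrite scalerDl.
  by rewrite big_split /= -!cE.
have cZ i a y : in_span s y -> c (a *: y) i = a * c y i.
  move=> sy; apply: (c_uniq _ (fun i => a * c y i)); first exact: submoduleZ.
  by under eq_bigr do rewrite -scalerA; rewrite -scaler_sumr -cE.
have coord0 i : \sum_(p <- l) c p.2 i *: p.1 = 0.
  apply: f_inj; rewrite linear0 linear_sum.
  have sW' w : w \in W -> in_span s w.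
    by move=> wW; apply: sW; rewrite mem_cat wW.
  have := eW (in_span s) (c^~ i) sW' (cD i) (cZ i).
  rewrite big_map big_nil /= => e0; rewrite -[RHS]e0.
  by apply: eq_bigr => p _; rewrite (linearZ_LR f).
rewrite tens_clsE.
transitivity (\sum_(p <- l) \sum_(i < size s) tens (c p.2 i *: p.1) s`_i).
  rewrite big_seq [RHS]big_seq; apply: eq_bigr => p pl.
  rewrite [in LHS](cE p.2) ?tens_sumr.
    by apply: eq_bigr => i _; rewrite tensZlr.
  by apply: sW; rewrite mem_cat map_f ?orbT.
rewrite exchange_big big1 // => i _.
by rewrite -tens_suml coord0 tens0l.
Qed.

Lemma torsion_free_flat (A : comPzRingType) (Q : lmodType A) :
  valuation_ring A -> torsion_free Q -> flat Q.
Proof. by move=> valA tfQ X X' f; exact: tens_mapl_inj. Qed.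

Section Swap.
Variables (A : comPzRingType).

Definition tens_swap (X Y : lmodType A) : tensor X Y -> tensor Y X :=
  tens_lift (fun x y => tens y x).

Lemma tens_swap_balanced (X Y : lmodType A) :
  balanced (fun (x : X) (y : Y) => tens y x).
Proof.
by split=> [y x x'|x y y'|a x y]; rewrite ?tensDr ?tensDl ?tensZlr.
Qed.

Lemma tens_swapE (X Y : lmodType A) (x : X) (y : Y) :
  tens_swap (tens x y) = tens y x.
Proof. exact/tens_liftE/tens_swap_balanced. Qed.

Lemma tens_swapD (X Y : lmodType A) : {morph @tens_swap X Y : z w / z + w}.
Proof. exact/tens_liftD/tens_swap_balanced. Qed.

Lemma tens_swap0 (X Y : lmodType A) : @tens_swap X Y 0 = 0.
Proof. exact/tens_lift0/tens_swap_balanced. Qed.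

Lemma tens_swapK (X Y : lmodType A) : cancel (@tens_swap X Y) (@tens_swap Y X).
Proof.
elim/tens_ind=> [|z w hz hw|x y]; first by rewrite !tens_swap0.
  by rewrite !tens_swapD hz hw.
by rewrite !tens_swapE.
Qed.
End Swap.

(** * The localization of [k[X]] at [(X)] *)

Section PolyLocalization.
Variable k : fieldType.

Definition nonvanishing : {pred {poly k}} := [pred q : {poly k} | q.[0] != 0].

Lemma nonvanishing_closed : mulr_closed nonvanishing.
Proof.
split=> [|p q]; rewrite !inE hornerE ?oner_neq0 // => p0 q0.
by rewrite mulf_neq0.
Qed.
HB.instance Definition _ :=
  GRing.isMulClosed.Build {poly k} nonvanishing nonvanishing_closed.

Definition locpoly : Type := locr nonvanishing.
HB.instance Definition _ := GRing.ComPzRing.on locpoly.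

Local Notation V := locpoly.
Implicit Types (p q : {poly k}) (s : denom nonvanishing) (v w : V).

Definition pfrac p s : V := fracr p s.

Lemma pfrac_surj v : exists p s, v = pfrac p s.
Proof. exact: fracr_surj. Qed.

Lemma denom_at0 s : (sval s).[0] != 0. Proof. exact: (valP s). Qed.

Lemma denom_neq0 s : sval s != 0.
Proof. by apply: contraTneq (denom_at0 s) => ->; rewrite horner0 eqxx. Qed.

Lemma pfracP p s q s' : pfrac p s = pfrac q s' <-> sval s' * p = sval s * q.
Proof.
split=> [/fracP[u Su e]|]; last exact: fracr_eq.
by apply: (mulfI (denom_neq0 (exist _ u Su))).
Qed.

Lemma pfracM p s q s' : pfrac p s * pfrac q s' = pfrac (p * q) (denomM s s').
Proof. exact: fracrM. Qed.

Lemma pfracD p s q s' : pfrac p s + pfrac q s' =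
  pfrac (sval s' * p + sval s * q) (denomM s s').
Proof. exact: fracrD. Qed.

Lemma pfrac_eq0 p s : pfrac p s = 0 <-> p = 0.
Proof.
rewrite -[0]/(pfrac 0 (denom1 _)) pfracP /= mul1r mulr0; split=> //.
Qed.

Lemma locpoly_nonzero : (1 : V) != 0.
Proof.
by apply/eqP => /pfrac_eq0/eqP; rewrite oner_eq0.
Qed.
HB.instance Definition _ := GRing.PzSemiRing_isNonZero.Build V locpoly_nonzero.

Definition locpoly_unit : {pred V} := fun v => `[< exists w, w * v = 1 >].
Definition locpoly_inv v : V :=
  if pselect (exists w, w * v = 1) is left e then projT1 (cid e) else v.

Lemma locpoly_mulVr : {in locpoly_unit, left_inverse 1 locpoly_inv *%R}.
Proof.
move=> v /asboolP vu; rewrite /locpoly_inv; case: pselect => // e.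
by case: cid.
Qed.
Lemma locpoly_unitP v w : w * v = 1 -> locpoly_unit v.
Proof. by move=> e; apply/asboolP; exists w. Qed.
Lemma locpoly_inv_out : {in [predC locpoly_unit], locpoly_inv =1 id}.
Proof.
move=> v; rewrite inE /= => /asboolP nv.
by rewrite /locpoly_inv; case: pselect.
Qed.
HB.instance Definition _ := GRing.ComNzRing_hasMulInverse.Build V
  locpoly_mulVr locpoly_unitP locpoly_inv_out.

Lemma locpoly_idomain : GRing.integral_domain_axiom V.
Proof.
move=> v w; have [p [s ->]] := pfrac_surj v; have [q [s' ->]] := pfrac_surj w.
rewrite pfracM => /pfrac_eq0/eqP; rewrite mulf_eq0.
by case/orP => /eqP->; apply/orP; [left|right]; apply/eqP/pfrac_eq0.
Qed.
HB.instance Definition _ :=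
  GRing.ComUnitRing_isIntegral.Build V locpoly_idomain.


Definition locpolyC (c : k) : V := pfrac c%:P (denom1 _).

Lemma locpolyC_zmod_morphism : zmod_morphism locpolyC.
Proof.
apply: morphD_zmod => a b; rewrite pfracD; apply/pfracP.
by rewrite /= !mul1r polyCD.
Qed.
Lemma locpolyC_monoid_morphism : monoid_morphism locpolyC.
Proof.
by split=> // a b; rewrite pfracM; apply/pfracP; rewrite /= !mul1r polyCM.
Qed.
HB.instance Definition _ :=
  GRing.isZmodMorphism.Build k V locpolyC locpolyC_zmod_morphism.
HB.instance Definition _ :=
  GRing.isMonoidMorphism.Build k V locpolyC locpolyC_monoid_morphism.

Definition locpolyX : V := pfrac 'X (denom1 _).
Local Notation t := locpolyX.

(** Evaluation at [0], through representatives; [at0E] shows independence of the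
    representative. *)
Definition at0 : V -> k := locked (fun v =>
  let z := repr (v : loc (nonvanishing) {poly k}^o) in
  (z.1 : {poly k}).[0] / (sval z.2).[0]).

Lemma at0E p s : at0 (pfrac p s) = p.[0] / (sval s).[0].
Proof.
rewrite /at0 -lock /=; set z := repr _.
have /pfracP/(congr1 (fun q => q.[0])) : pfrac z.1 z.2 = pfrac p s.
  exact: fracK.
rewrite !hornerM mulrC => e.
by apply/eqP; rewrite eqr_div ?denom_at0 // e mulrC.
Qed.

Lemma at0D : {morph at0 : v w / v + w}.
Proof.
move=> v w; have [p [s ->]] := pfrac_surj v; have [q [s' ->]] := pfrac_surj w.
rewrite pfracD !at0E /= hornerD !hornerM addf_div ?denom_at0 //.
by congr ((_ + _) / _); rewrite mulrC.
Qed.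

Lemma at0M : {morph at0 : v w / v * w}.
Proof.
move=> v w; have [p [s ->]] := pfrac_surj v; have [q [s' ->]] := pfrac_surj w.
by rewrite pfracM !at0E /= !hornerM mulf_div.
Qed.

Lemma at0C c : at0 (locpolyC c) = c.
Proof. by rewrite at0E /= !hornerC divr1. Qed.

Lemma at0X : at0 t = 0.
Proof. by rewrite at0E hornerX mul0r. Qed.

Lemma locpoly_decomp v : exists w, v = locpolyC (at0 v) + t * w.
Proof.
have [p [s ->]] := pfrac_surj v; set c := at0 _.
have /factor_theorem[q eq] : root (p - c%:P * sval s) 0.
  rewrite rootE !hornerE /c at0E.
  by rewrite divfK ?denom_at0 // subrr.
exists (pfrac q s); rewrite pfracM pfracD; apply/pfracP => /=.
rewrite !mul1r; congr (_ * _).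
move/eqP: eq; rewrite subr_eq subr0 => /eqP->.
by rewrite addrC mulrC ['X * _]mulrC.
Qed.

Lemma locpoly_unitE v : (v \is a GRing.unit) = (at0 v != 0).
Proof.
apply/idP/idP => [vu|].
  apply: contraTneq (oner_neq0 k) => v0; rewrite -[1]at0C.
  by rewrite -[locpolyC 1](mulVr vu) at0M v0 mulr0 eqxx.
have [p [s ->]] := pfrac_surj v; rewrite at0E mulf_eq0 negb_or => /andP[p0 _].
apply: (@locpoly_unitP _ (pfrac (sval s) (exist _ p p0))).
rewrite pfracM -[1]/(pfrac 1 (denom1 _)); apply/pfracP.
by rewrite /= mul1r mulr1 mulrC.
Qed.

Lemma locpolyX_neq0 : t != 0.
Proof. by apply/eqP => /pfrac_eq0/eqP; rewrite polyX_eq0. Qed.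

Lemma locpoly_factor v : v != 0 ->
  exists n u, u \is a GRing.unit /\ v = t ^+ n * u.
Proof.
have [p [s ->]] := pfrac_surj v => ps0.
have p0 : p != 0 by apply: contra_neq ps0 => ->; apply/pfrac_eq0.
have [n [q nq ep]] := multiplicity_XsubC p 0; rewrite p0 /= in nq.
rewrite subr0 in ep.
exists n, (pfrac q s); split.
  by rewrite locpoly_unitE at0E mulf_neq0 ?invr_eq0 ?denom_at0.
have -> : t ^+ n = pfrac 'X^n (denom1 _).
  by rewrite -[t]/(to_loc _ 'X) -rmorphXn.
by rewrite pfracM; apply/pfracP; rewrite /= ep mul1r [q * _]mulrC.
Qed.

Lemma locpoly_valuation : valuation_ring V.
Proof.
move=> v w; have [->|v0] := eqVneq v 0; first by right; exists 0; rewrite mul0r.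
have [->|w0] := eqVneq w 0; first by left; exists 0; rewrite mul0r.
have [m [u [uu ->]]] := locpoly_factor v0.
have [n [u' [uu' ->]]] := locpoly_factor w0.
have [mn|/ltnW nm] := leqP m n; [left|right].
  exists (t ^+ (n - m) * u' / u).
  by rewrite mulrCA divrK // mulrA -exprD subnKC.
exists (t ^+ (m - n) * u / u').
by rewrite mulrCA divrK // mulrA -exprD subnKC.
Qed.

Lemma mem_ideal1 v w : w \in ideal_mul V^o [:: v] <-> exists u, w = v * u.
Proof. exact: (@mem_ideal_mul1 V V^o). Qed.

Lemma locpoly_nonunit v : v \isn't a GRing.unit <-> v \in ideal_mul V^o [:: t].
Proof.
rewrite mem_ideal1 locpoly_unitE negbK; split=> [/eqP v0|[w ->]].
  by have [w ->] := locpoly_decomp v; exists w; rewrite v0 rmorph0 add0r.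
by rewrite at0M at0X mul0r.
Qed.

(** A nonzero ideal is generated by the least power of [t] in it. *)
Lemma locpoly_dvr : is_dvr V.
Proof.
split.
- move=> I; have [I0|nI] := pselect (forall v : V, v \in I -> v = 0).
    exists 0 => v; apply/idP/idP => [/I0 ->|/mem_ideal1[w ->]].
      by rewrite rpred0.
    by rewrite mul0r rpred0.
  have exn : exists n, `[< t ^+ n \in (I : {pred V^o}) >].
    apply: contrapT => nn; apply: nI => v Iv; apply/eqP.
    apply: contrapT => /negP v0; have [n [u [uu ev]]] := locpoly_factor v0.
    apply: nn; exists n; apply/asboolP.
    have -> : t ^+ n = u^-1 * v by rewrite ev mulrCA mulVr // mulr1.
    exact: (@rpredZ _ _ I u^-1).
  have [n /asboolP In nmin] := ex_minnP exn; exists (t ^+ n) => v.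
  apply/idP/idP => [Iv|/mem_ideal1[w ->]]; last first.
    by rewrite mulrC; exact: (@rpredZ _ _ I w).
  apply/mem_ideal1; have [->|v0] := eqVneq v 0.
    by exists 0; rewrite mulr0.
  have [m [u [uu ev]]] := locpoly_factor v0.
  have /nmin nm : `[< t ^+ m \in (I : {pred V^o}) >].
    apply/asboolP.
    have -> : t ^+ m = u^-1 * v by rewrite ev mulrCA mulVr // mulr1.
    exact: (@rpredZ _ _ I u^-1).
  by exists (t ^+ (m - n) * u); rewrite mulrA -exprD subnKC.
- move=> v w; rewrite !locpoly_unitE !negbK at0D => /eqP-> /eqP->.
  by rewrite addr0.
- by exists t; rewrite locpolyX_neq0 locpoly_unitE at0X eqxx.
Qed.

Lemma locpoly_residue :
  bijective (fun c => \pi_(quotm (ideal_mul V^o [:: t]))%qT (locpolyC c)).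
Proof.
exists (fun z => at0 (repr z)) => [c|z].
  have : repr (\pi_(quotm (ideal_mul V^o [:: t]))%qT (locpolyC c)) - locpolyC c
      \in ideal_mul V^o [:: t] by apply/quotmP; rewrite reprK.
  case/mem_ideal1 => w /eqP; rewrite subr_eq => /eqP->.
  by rewrite at0D at0M at0X mul0r add0r at0C.
rewrite -[RHS]reprK; apply/quotmP; have [w {2}->] := locpoly_decomp (repr z).
by rewrite opprD addrA subrr add0r -mulrN; apply/mem_ideal1; exists (- w).
Qed.

End PolyLocalization.

(** * Isomorphisms and tensor products of modules *)

Lemma lmod_iso_sym (A : comPzRingType) (X Y : lmodType A) :
  lmod_iso X Y -> lmod_iso Y X.
Proof.
move=> [f [g fK gK]]; have gL : linear g.
  by move=> a u v; apply: (can_inj fK); rewrite gK linearP !gK.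
pose g' : {linear Y -> X} := HB.pack g (GRing.isLinear.Build _ _ _ _ g gL).
by exists g'; exists f.
Qed.

Lemma bij_lmod_iso (A : comPzRingType) (X Y : lmodType A) (f : X -> Y) :
  linear f -> (forall u, f u = 0 -> u = 0) -> (forall y, exists u, f u = y) ->
  lmod_iso X Y.
Proof.
move=> fL f0 /choice[g gK].
pose f' : {linear X -> Y} := HB.pack f (GRing.isLinear.Build _ _ _ _ f fL).
exists f'; exists g => // u; apply/eqP; rewrite -subr_eq0; apply/eqP/f0.
by rewrite -[LHS]/(f' _) linearB /= gK subrr.
Qed.

(** First isomorphism theorem, for a map that is linear only over a ring [A]
    acting through [h]. *)
Lemma quotm_lmod_iso (A B : comPzRingType) (h : {rmorphism A -> B})
    (X : lmodType B) (S : submodClosed X) (Y : lmodType A) (f : X -> Y) :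
  {morph f : u v / u + v} -> (forall a u, f (h a *: u) = a *: f u) ->
  (forall y, exists u, f u = y) -> (forall u, f u = 0 <-> u \in S) ->
  lmod_iso (restr h (quotm S)) Y.
Proof.
move=> fD fZ f_surj fS.
have f0 : f 0 = 0 by apply: (addrI (f 0)); rewrite -fD !addr0.
have fN u : f (- u) = - f u by apply: (addrI (f u)); rewrite -fD !subrr.
pose g (z : restr h (quotm S)) : Y := f (repr (z : quotm S)).
have gE u : g (\pi_(quotm S)%qT u) = f u.
  apply/eqP; rewrite -subr_eq0 /g -fN -fD; apply/eqP/fS/quotmP.
  by rewrite reprK.
apply: (bij_lmod_iso (f := g)).
- move=> a z w; have [{}z ->] := quotm_surj (z : quotm S).
  have [{}w ->] := quotm_surj (w : quotm S).
  rewrite -[a *: _]/(h a *: (\pi_(quotm S)%qT z : quotm S)).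
  rewrite -[_ *: _]/(quotm_scale _ _) quotm_scaleE.
  rewrite -[X in g X]/(\pi_(quotm S)%qT _ + \pi_(quotm S)%qT _ : quotm S).
  rewrite quotmD.
  by rewrite !gE fD fZ.
- move=> z; have [{}z ->] := quotm_surj (z : quotm S).
  by rewrite gE => /fS/quotm_eq0.
- by move=> y; have [u <-] := f_surj y; exists (\pi_(quotm S)%qT u).
Qed.

Lemma ptens0l (k A B : comPzRingType) (i : {rmorphism k -> A})
    (j : {rmorphism k -> B}) (X : lmodType A) (Y : lmodType B) (y : Y) :
  ptens i j (0 : X) y = 0.
Proof. exact: (@tens0l k (restr i X) (restr j Y)). Qed.

Section TensorMap.
Variables (k A B : comPzRingType).
Variables (i : {rmorphism k -> A}) (j : {rmorphism k -> B}).
Variables (X Y : lmodType A) (Z : lmodType B) (f : {linear X -> Y}).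

Definition restr_map (x : restr i X) : restr i Y := f x.

Lemma restr_map_linear : linear restr_map.
Proof. by move=> a u v; rewrite /restr_map (linearD f) (linearZ_LR f). Qed.
HB.instance Definition _ :=
  GRing.isLinear.Build k (restr i X) (restr i Y) *:%R restr_map
    restr_map_linear.

Definition tmap : tmod i j X Z -> tmod i j Y Z := tens_mapl restr_map.

Lemma tmapE x z : tmap (ptens i j x z) = ptens i j (f x) z.
Proof. exact: (tens_maplE restr_map). Qed.

Lemma tmapD : {morph tmap : u v / u + v}.
Proof. exact/tens_liftD/tens_mapl_balanced. Qed.

Lemma tmap0 : tmap 0 = 0.
Proof. exact/tens_lift0/tens_mapl_balanced. Qed.

Lemma tmapZ c u : tmap (c *: u) = c *: tmap u.
Proof.
elim/(@ptens_ind _ _ _ i j): u => [|u v hu hv|x z].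
- by rewrite scaler0 tmap0 scaler0.
- by rewrite scalerDr !tmapD hu hv scalerDr.
elim/(@rtens_ind _ _ _ i j): c => [|c d hc hd|a b].
- by rewrite !scale0r tmap0.
- by rewrite !scalerDl tmapD hc hd.
by rewrite tmapE !ptensE tmapE (linearZ_LR f).
Qed.

Lemma tmap_linear : linear tmap.
Proof. by move=> c u v; rewrite tmapD tmapZ. Qed.
HB.instance Definition _ :=
  GRing.isLinear.Build (tring i j) (tmod i j X Z) (tmod i j Y Z) *:%R tmap
    tmap_linear.
End TensorMap.
Arguments restr_map {k A} i {X Y} f _.
Arguments tmap {k A B} i j {X Y} Z f _.

Lemma torsion_free_field (k : fieldType) (X : lmodType k) : torsion_free X.
Proof.
move=> a u au; have [->|a0] := eqVneq a 0; [by left|right].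
by rewrite -[u]scale1r -(mulVf a0) -scalerA au scaler0.
Qed.

Lemma valuation_field (k : fieldType) : valuation_ring k.
Proof.
move=> a b; have [->|a0] := eqVneq a 0; first by right; exists 0; rewrite mul0r.
by left; exists (b / a); rewrite divfK.
Qed.

(** A field is a valuation ring, and all its modules are torsion-free; so the
    flatness of torsion-free modules also covers tensor products over [k]. *)
Section FieldTensor.
Variables (k : fieldType) (A B : comPzRingType).
Variables (i : {rmorphism k -> A}) (j : {rmorphism k -> B}).

Lemma tmap_inj (X Y : lmodType A) (Z : lmodType B) (f : {linear X -> Y}) :
  injective f -> injective (tmap i j Z f).
Proof.
move=> f_inj; apply: tens_mapl_inj; last exact: f_inj.
  exact: valuation_field.
exact: torsion_free_field.
Qed.

Lemma tinl_regular (X : lmodType A) (Z : lmodType B) (a : A) :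
  regular_elt X a -> regular_elt (tmod i j X Z) (tinl i j a).
Proof.
move=> areg u.
have -> : tinl i j a *: u = tmap i j Z ( *:%R a : {linear X -> X}) u.
  elim/(@ptens_ind _ _ _ i j): u => [|u v hu hv|x z].
  - by rewrite scaler0 linear0.
  - by rewrite scalerDr linearD hu hv.
  by rewrite ptensE tmapE scale1r.
move=> u0; apply: (@tmap_inj X X Z ( *:%R a : {linear X -> X})) => [x y e|].
  by apply/eqP; rewrite -subr_eq0; apply/eqP/areg; rewrite scalerBr e subrr.
by rewrite u0 linear0.
Qed.

Lemma tinr_regular (X : lmodType A) (Z : lmodType B) (b : B) :
  regular_elt Z b -> regular_elt (tmod i j X Z) (tinr i j b).
Proof.
move=> breg u.
pose g : {linear restr j Z -> restr j Z} :=
  restr_map j ( *:%R b : {linear Z -> Z}).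
have eu : tens_swap (tinr i j b *: u : tensor (restr i X) (restr j Z)) =
    tens_mapl g (tens_swap (u : tensor (restr i X) (restr j Z))).
  elim/(@ptens_ind _ _ _ i j): u => [|u v hu hv|x z].
  - rewrite scaler0  tens_swap0 [RHS](tens_lift0 (tens_mapl_balanced _ g)) //.
  - rewrite scalerDr  !tens_swapD hu hv.
    by rewrite [RHS](tens_liftD (tens_mapl_balanced _ g)).
  by rewrite ptensE  !tens_swapE tens_maplE scale1r.
move=> u0; apply: (can_inj (@tens_swapK k (restr i X) (restr j Z))).
rewrite tens_swap0; apply: (@tens_mapl_inj _ _ _ (restr i X) g) => //.
- exact: valuation_field.
- exact: torsion_free_field.
- move=> y z e; apply/eqP; rewrite -subr_eq0; apply/eqP/breg.
  by rewrite scalerBr [b *: y]e subrr.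
by rewrite -eu u0 tens_swap0 /tens_mapl (tens_lift0 (tens_mapl_balanced _ g)).
Qed.

End FieldTensor.

Lemma fin_gen_tmod (k A B : comPzRingType) (i : {rmorphism k -> A})
    (j : {rmorphism k -> B}) (X : lmodType A) :
  fin_gen X -> fin_gen (tmod i j X B^o).
Proof.
move=> /fin_genP[s sX]; apply/fin_genP.
exists [seq ptens i j x (1 : B^o) | x <- s] => u; split=> Q sQ Qs.
have Q1 x : Q (ptens i j x (1 : B^o)).
  apply: (in_span_sub (sX x) (P := fun x => Q (ptens i j x (1 : B^o)))).
    split=> [|y z Qy Qz|a y Qy].
    - by rewrite ptens0l; exact: submodule0.
    - by rewrite ptensDl; apply: submoduleD.
    - by rewrite -[1 : B^o]scale1r -ptensE; apply: submoduleZ.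
  by move=> v vs; exact/Qs/map_f.
elim/(@ptens_ind _ _ _ i j): u => [|u v|x b]; first exact: submodule0.
  exact: submoduleD.
rewrite -[x]scale1r -[b]mulr1 -[b * 1]/(b *: (1 : B^o)) -ptensE.
exact: submoduleZ.
Qed.

(** * Evaluation at [t = 0] *)

Section Evaluation.
Variables (k A : comPzRingType) (V : comPzRingType).
Variables (i : {rmorphism k -> A}) (j : {rmorphism k -> V}) (t : V).
Variable at0 : V -> k.
Hypotheses (at0D : {morph at0 : v w / v + w}).
Hypotheses (at0Z : forall c v, at0 (j c * v) = c * at0 v).
Hypotheses (at01 : at0 1 = 1) (at0t : forall v, at0 (t * v) = 0).
Hypothesis at0_decomp : forall v, exists w, v = j (at0 v) + t * w.

Section Module.
Variable X : lmodType A.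

Definition ev_pure (x : restr i X) (v : restr j V^o) : X :=
  i (at0 v) *: (x : X).

Lemma ev_balanced : balanced ev_pure.
Proof.
split=> [v x x'|x v v'|c x v]; rewrite /ev_pure.
- by rewrite scalerDr.
- by rewrite at0D rmorphD scalerDl.
rewrite -[c *: v]/(j c * (v : V)) at0Z -[c *: x]/(i c *: (x : X)) scalerA.
by rewrite rmorphM mulrC.
Qed.

Definition ev : tmod i j X V^o -> X := tens_lift ev_pure.

Lemma evE x v : ev (ptens i j x (v : V^o)) = i (at0 v) *: x.
Proof. exact: (tens_liftE ev_balanced). Qed.
Lemma evD : {morph ev : z w / z + w}.
Proof. exact: (tens_liftD ev_balanced). Qed.
Lemma ev0 : ev 0 = 0.
Proof. exact: (tens_lift0 ev_balanced). Qed.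

Lemma ev1 x : ev (ptens i j x (1 : V^o)) = x.
Proof. by rewrite evE at01 rmorph1 scale1r. Qed.

Lemma ev_tinl a z : ev (tinl i j a *: z) = a *: ev z.
Proof.
elim/(@ptens_ind _ _ _ i j): z => [|z w hz hw|x v].
- by rewrite scaler0 ev0 scaler0.
- by rewrite scalerDr !evD hz hw scalerDr.
by rewrite ptensE scale1r !evE !scalerA mulrC.
Qed.

Lemma ev_tinr z : ev (tinr i j t *: z) = 0.
Proof.
elim/(@ptens_ind _ _ _ i j): z => [|z w hz hw|x v].
- by rewrite scaler0 ev0.
- by rewrite scalerDr evD hz hw addr0.
by rewrite ptensE evE at0t rmorph0 scale0r.
Qed.

Lemma ev_decomp z :
  exists w, z = ptens i j (ev z) (1 : V^o) + tinr i j t *: w.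
Proof.
elim/(@ptens_ind _ _ _ i j): z => [|z w [z' ez] [w' ew]|x v].
- by exists 0; rewrite ev0 scaler0 addr0 ptens0l.
- by exists (z' + w'); rewrite evD ptensDl scalerDr addrACA -ez -ew.
have [w ew] := at0_decomp v; exists (ptens i j x (w : V^o)).
rewrite ptensE scale1r evE ptensZ -ptensDr; congr ptens.
by rewrite {1}ew -[_ *: (1 : V^o)]/(_ * 1) mulr1.
Qed.

End Module.

Lemma ev_tmap (X Y : lmodType A) (f : {linear X -> Y}) z :
  ev (tmap i j V^o f z) = f (ev z).
Proof.
elim/(@ptens_ind _ _ _ i j): z => [|z w hz hw|x v].
- by rewrite linear0 !ev0 linear0.
- by rewrite linearD !evD hz hw linearD.
by rewrite tmapE !evE (linearZ_LR f).
Qed.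

End Evaluation.

(** * Inverting [t] *)

Section LocTensor.
Variables (k A B : comPzRingType).
Variables (i : {rmorphism k -> A}) (j : {rmorphism k -> B}) (t : B).
Variables (X : lmodType A) (Q : lmodType (tring i j)).
Variable phi : {linear tmod i j X B^o -> Q}.

Local Notation S := (powers t).
Local Notation t' := (tinr i j t).
Local Notation S' := (powers t').
Local Notation jt := (to_loc_alg j t).
Local Notation XT := (tmod i jt X (locr S)^o).

Definition loc_phi_pure (x : restr i X) (w : restr jt (locr S)^o) : loc S' Q :=
  locr_tinr i j w *: frac (phi (ptens i j (x : X) (1 : B^o))) (denom1 S').

Lemma locr_tinrZ c (w : locr S) :
  locr_tinr i j (jt c * w) = to_loc S' (tinl i j (i c)) * locr_tinr i j w.
Proof.
have [_ _ h] := tloc_balanced i j t.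
have := h c (1 : A^o) (w : (locr S)^o); rewrite /tloc_pure.
rewrite -[_ *: (1 : restr i A^o)]/(i c * 1) mulr1 !rmorph1 mul1r.
by move=> e; apply/esym; exact: e.
Qed.

Lemma loc_phi_balanced : balanced loc_phi_pure.
Proof.
split=> [w x x'|x w w'|c x w]; rewrite /loc_phi_pure.
- by rewrite ptensDl linearD frac_addl scalerDr.
- by rewrite locr_tinrD scalerDl.
rewrite -[c *: w]/(jt c * (w : locr S)) locr_tinrZ -[c *: x]/(i c *: (x : X)).
rewrite mulrC -scalerA to_loc_frac -(linearZ_LR phi) ptensE.
by rewrite scale1r.
Qed.

(** [phi] with [t] inverted, as a map from [X (x) B_t]. *)
Definition loc_phi : XT -> loc S' Q := tens_lift loc_phi_pure.

Lemma loc_phiE x (w : locr S) : loc_phi (ptens i jt x (w : (locr S)^o)) =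
  locr_tinr i j w *: frac (phi (ptens i j x (1 : B^o))) (denom1 S').
Proof. exact: (tens_liftE loc_phi_balanced). Qed.
Lemma loc_phiD : {morph loc_phi : z w / z + w}.
Proof. exact: (tens_liftD loc_phi_balanced). Qed.
Lemma loc_phi0 : loc_phi 0 = 0.
Proof. exact: (tens_lift0 loc_phi_balanced). Qed.

Lemma loc_phiZ c z : loc_phi (c *: z) = tloc i j t c *: loc_phi z.
Proof.
elim/(@ptens_ind _ _ _ i jt): z => [|z w hz hw|x w].
- by rewrite scaler0 loc_phi0 scaler0.
- by rewrite scalerDr !loc_phiD hz hw scalerDr.
elim/(@rtens_ind _ _ _ i jt): c => [|c d hc hd|a b].
- by rewrite scale0r rmorph0 scale0r loc_phi0.
- by rewrite scalerDl loc_phiD hc hd rmorphD scalerDl.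
have -> : tloc i j t (rtens i jt a b) =
    to_loc S' (tinl i j a) * locr_tinr i j b.
  exact: (tens_liftE (tloc_balanced i j t)).
rewrite ptensE !loc_phiE -[b *: _]/(b * w) locr_tinrM.
have -> : frac (phi (ptens i j (a *: x) (1 : B^o))) (denom1 S') =
    to_loc S' (tinl i j a) *: frac (phi (ptens i j x (1 : B^o))) (denom1 S').
  by rewrite to_loc_frac -(linearZ_LR phi) ptensE scale1r.
by rewrite !scalerA; congr (_ *: _); rewrite mulrC mulrA.
Qed.

Definition scalar_ext : tmod i j X B^o -> XT :=
  tens_lift (fun (x : restr i X) (b : restr j B^o) =>
    ptens i jt (x : X) (to_loc S (b : B) : (locr S)^o)).

Lemma scalar_ext_balanced :
  balanced (fun (x : restr i X) (b : restr j B^o) =>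
    ptens i jt (x : X) (to_loc S (b : B) : (locr S)^o)).
Proof.
split=> [b x x'|x b b'|c x b].
- by rewrite ptensDl.
- by rewrite rmorphD ptensDr.
rewrite -[c *: x]/(i c *: (x : X)) ptensZ; congr ptens.
by rewrite -[c *: b]/(j c * (b : B)) rmorphM.
Qed.

Lemma scalar_extE x (b : B) : scalar_ext (ptens i j x (b : B^o)) =
  ptens i jt x (to_loc S b : (locr S)^o).
Proof. exact: (tens_liftE scalar_ext_balanced). Qed.
Lemma scalar_extD : {morph scalar_ext : z w / z + w}.
Proof. exact: (tens_liftD scalar_ext_balanced). Qed.
Lemma scalar_ext0 : scalar_ext 0 = 0.
Proof. exact: (tens_lift0 scalar_ext_balanced). Qed.

Lemma scalar_ext_tinr b u :
  scalar_ext (tinr i j b *: u) = tinr i jt (to_loc S b) *: scalar_ext u.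
Proof.
elim/(@ptens_ind _ _ _ i j): u => [|u v hu hv|x b'].
- by rewrite scaler0 scalar_ext0 scaler0.
- by rewrite scalerDr !scalar_extD hu hv scalerDr.
by rewrite ptensE !scalar_extE ptensE !scale1r rmorphM.
Qed.

(** Finitely many fractions have a common denominator. *)
Lemma scalar_ext_surj z : exists s u, z = tinr i jt (fracr 1 s) *: scalar_ext u.
Proof.
elim/(@ptens_ind _ _ _ i jt): z => [|z w [s [u ez]] [s' [u' ew]]|x w].
- by exists (denom1 S), 0; rewrite scalar_ext0 scaler0.
- exists (denomM s s'), (tinr i j (sval s') *: u + tinr i j (sval s) *: u').
  rewrite scalar_extD !scalar_ext_tinr scalerDr !scalerA -!rmorphM ez ew.
  by congr (tinr _ _ _ *: _ + tinr _ _ _ *: _); rewrite fracrM;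
    apply: fracr_eq => /=; ring.
have [b [s ->]] := fracr_surj w.
exists s, (ptens i j x (b : B^o)); rewrite scalar_extE ptensE scale1r.
congr ptens; rewrite -[RHS]/(fracr 1 s * to_loc S b) fracrM.
by apply: fracr_eq => /=; ring.
Qed.

Lemma loc_phi_ext s u :
  loc_phi (tinr i jt (fracr 1 s) *: scalar_ext u) = frac (phi u) (tdenom i j s).
Proof.
rewrite loc_phiZ.
have -> : tloc i j t (tinr i jt (fracr 1 s)) = fracr 1 (tdenom i j s).
  exact: tlocE.
suff -> : loc_phi (scalar_ext u) = frac (phi u) (denom1 S').
  by rewrite fracZ; apply: frac_eq; rewrite /= scale1r mulr1.
elim/(@ptens_ind _ _ _ i j): u => [|u v hu hv|x b].
- rewrite scalar_ext0 loc_phi0 linear0; apply/esym/frac_eq0.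
  by exists 1; [exact: rpred1|rewrite scaler0].
- by rewrite scalar_extD loc_phiD hu hv linearD frac_addl.
rewrite scalar_extE loc_phiE locr_tinrE fracZ -(linearZ_LR phi) ptensE scale1r.
rewrite -[b *: (1 : B^o)]/(b * 1) mulr1.
by apply: frac_eq; rewrite /= rmorph1 mul1r.
Qed.

(** Inverting [t] makes [phi] surjective when its image contains a [t]-multiple
    of every element, and preserves its injectivity. *)
Lemma loc_lmod_iso : injective phi -> regular_elt (tmod i j X B^o) t' ->
  (forall q, exists n u, t' ^+ n *: q = phi u) ->
  lmod_iso (restr (tloc i j t) (loc S' Q)) XT.
Proof.
move=> phi_inj t_reg phi_t; apply: lmod_iso_sym.
apply: (@bij_lmod_iso _ XT (restr (tloc i j t) (loc S' Q)) loc_phi).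
- by move=> c z w; rewrite loc_phiD loc_phiZ.
- move=> z; have [s [u ->]] := scalar_ext_surj z; rewrite loc_phi_ext.
  move=> /frac_eq0[_ /asboolP[n ->]]; rewrite -(linearZ_LR phi).
  rewrite -[0](linear0 phi) => /phi_inj tu.
  suff -> : u = 0 by rewrite scalar_ext0 scaler0.
  elim: n tu => [|n ih]; first by rewrite scale1r.
  by rewrite exprS -scalerA => /t_reg.
move=> z; have [q [s ->]] := frac_surj (z : loc S' Q).
have /asboolP[m es] := valP s; have [n [u eu]] := phi_t q.
have tS : t ^+ (m + n) \in S by apply/asboolP; exists (m + n)%N.
exists (tinr i jt (fracr 1 (exist (fun s => s \in S) _ tS)) *: scalar_ext u).
rewrite loc_phi_ext -eu; apply: frac_eq.
by rewrite /= scalerA es rmorphXn exprD.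
Qed.
End LocTensor.

(** * The deformation *)

Section Deformation.
Variables (k : fieldType) (R V : comPzRingType).
Variables (i : {rmorphism k -> R}) (j : {rmorphism k -> V}) (t : V).
Variables (L : lmodType R) (alpha : {linear L -> L}) (x : R).
Variable M : submodClosed L.
Hypothesis im_ker : forall y, alpha y = 0 <-> exists z, y = alpha z.
Hypothesis x_reg : regular_elt L x.
Hypotheses (aM : forall u, alpha u \in M) (xM : forall u, x *: u \in M).
Hypothesis t_reg : regular_elt V^o t.

Local Notation T := (tring i j).
Local Notation LV := (tmod i j L V^o).
Local Notation MV := (tmod i j (submod M) V^o).
Local Notation t' := (tinr i j t).
Local Notation x' := (tinl i j x).

Definition alphaM (u : L) : submod M := Submod (aM u).
Definition mulxM (u : L) : submod M := Submod (xM u).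

Lemma alphaM_linear : linear alphaM.
Proof. by move=> a u v; apply: val_inj; rewrite /= linearP. Qed.
Lemma mulxM_linear : linear mulxM.
Proof.
by move=> a u v; apply: val_inj; rewrite /= scalerDr !scalerA mulrC.
Qed.
HB.instance Definition _ :=
  GRing.isLinear.Build R L (submod M) *:%R alphaM alphaM_linear.
HB.instance Definition _ :=
  GRing.isLinear.Build R L (submod M) *:%R mulxM mulxM_linear.

Local Notation valM := (val : {linear submod M -> L}).

(** [alpha + t x] on [M (x) V]. *)
Definition Phi (u : MV) : LV :=
  tmap i j V^o alpha (tmap i j V^o valM u) +
  (t' * x') *: tmap i j V^o valM u.

Lemma Phi_linear : linear Phi.
Proof.
move=> c u v; rewrite /Phi (linearP (tmap i j V^o valM)).
rewrite (linearP (tmap i j V^o alpha)) !scalerDr addrACA.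
by congr (_ + _ + _); rewrite !scalerA mulrC.
Qed.
HB.instance Definition _ := GRing.isLinear.Build T MV LV *:%R Phi Phi_linear.

Lemma PhiE m (v : V) : Phi (ptens i j m (v : V^o)) =
  ptens i j (alpha (val m)) (v : V^o) +
  ptens i j (x *: val m) ((t * v : V) : V^o).
Proof.
rewrite /Phi !tmapE -scalerA ptensE ptensE !scale1r.
by [].
Qed.

(** [alpha - t x] on [L (x) V]; its values lie in [M (x) V], because [M]
    contains [alpha L + x L]. *)
Definition Psi (w : LV) : MV :=
  tmap i j V^o alphaM w - t' *: tmap i j V^o mulxM w.

Lemma PsiD : {morph Psi : u v / u + v}.
Proof. by move=> u v; rewrite /Psi !tmapD scalerDr opprD addrACA. Qed.

Lemma Phi_Psi w : Phi (Psi w) = - (t' ^+ 2 * tinl i j (x ^+ 2)) *: w.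
Proof.
elim/(@ptens_ind _ _ _ i j): w => [|u v hu hv|l v].
- by rewrite /Psi !tmap0 !scaler0 subrr (linear0 Phi).
- by rewrite PsiD (linearD Phi) /= hu hv scalerDr.
rewrite /Psi !tmapE ptensE scale1r (linearB Phi) /= !PhiE /=.
rewrite (alpha_alpha im_ker) ptens0l add0r.
rewrite (linearZ_LR alpha) opprD addrA -[t *: v]/(t * v) subrr add0r.
rewrite scaleNr -rmorphXn -scalerA !ptensE !scale1r; congr (- ptens _ _ _ _).
  by rewrite scalerA expr2.
by rewrite -[_ *: v]/(t ^+ 2 * v) expr2 mulrA.
Qed.

(** If [alpha w = - t x w], then
    [t^2 x^2 w = - t x (alpha w) = alpha (alpha w) = 0], and [t] and [x] are
    regular on [L (x) V]. *)
Lemma Phi_inj : injective Phi.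
Proof.
have valM_inj : injective (tmap i j V^o valM).
  by apply: tmap_inj; exact: val_inj.
suff ker0 u : Phi u = 0 -> u = 0.
  move=> u v e; apply/eqP; rewrite -subr_eq0; apply/eqP/ker0.
  by rewrite (linearB Phi) /= e subrr.
move=> u0; apply: valM_inj; rewrite linear0; move: u0; rewrite /Phi.
move: (tmap _ _ _ _ u) => w /eqP; rewrite addr_eq0 => /eqP aw.
have aaw : tmap i j V^o alpha (tmap i j V^o alpha w) = 0.
  elim/(@ptens_ind _ _ _ i j): w {aw} => [|u1 u2 h1 h2|l v].
  - by rewrite !tmap0.
  - by rewrite !tmapD h1 h2 addr0.
  by rewrite !tmapE (alpha_alpha im_ker) ptens0l.
have eA : (t' * x') *: w = - tmap i j V^o alpha w by rewrite aw opprK.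
have : (t' * x') *: ((t' * x') *: w) = 0.
  by rewrite eA scalerN -tmapZ eA (linearN (tmap i j V^o alpha)) /= aaw !oppr0.
rewrite -!scalerA.
have tr : regular_elt LV t' by exact: tinr_regular.
have xr : regular_elt LV x' by exact: tinl_regular.
by move=> /tr/xr/tr/xr.
Qed.

Definition in_deformation (z : LV) : Prop :=
  exists u w, z = Phi u + tinl i j (x ^+ 2) *: w.

Lemma submodule_deformation : submodule in_deformation.
Proof.
split=> [|_ _ [u [w ->]] [u' [w' ->]]|c _ [u [w ->]]].
- by exists 0, 0; rewrite (linear0 Phi) scaler0 addr0.
- by exists (u + u'), (w + w'); rewrite (linearD Phi) scalerDr addrACA.
- exists (c *: u), (c *: w); rewrite (linearZ_LR Phi) scalerDr; congr (_ + _).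
  by rewrite !scalerA mulrC.
Qed.

Definition deformation := submod (pred_of_submodule submodule_deformation).

Lemma mem_deformation z :
  z \in pred_of_submodule submodule_deformation <-> in_deformation z.
Proof. by rewrite unfold_in; split=> /asboolP. Qed.

Lemma Phi_deformation u : Phi u \in pred_of_submodule submodule_deformation.
Proof. by apply/mem_deformation; exists u, 0; rewrite scaler0 addr0. Qed.

Definition Phi_corestr (u : MV) : deformation := Submod (Phi_deformation u).

Lemma Phi_corestr_linear : linear Phi_corestr.
Proof. by move=> c u v; apply: val_inj; rewrite /= (linearP Phi). Qed.
HB.instance Definition _ :=
  GRing.isLinear.Build T MV deformation *:%R Phi_corestr Phi_corestr_linear.

Lemma fin_gen_deformation :
  fin_gen (submod M) -> fin_gen L -> fin_gen deformation.
Proof.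
move=> /(fin_gen_tmod i j)/fin_genP[s1 s1M].
move=> /(fin_gen_tmod i j)/fin_genP[s2 s2L].
apply/fin_gen_submod.
exists (map Phi s1 ++ map ( *:%R (tinl i j (x ^+ 2))) s2); split=> [z|z].
  rewrite mem_cat => /orP[/mapP[u _ ->]|/mapP[w _ ->]].
    exact: Phi_deformation.
  by apply/mem_deformation; exists 0, w; rewrite (linear0 Phi) add0r.
move=> /mem_deformation[u [w ->]]; split=> P sP Ps; apply: submoduleD => //.
  apply: (in_span_sub (s1M u) (submodule_preim_linear Phi sP)) => v vs1.
  by apply: Ps; rewrite mem_cat map_f.
apply: (in_span_sub (s2L w)
  (submodule_preim_linear ( *:%R (tinl i j (x ^+ 2))) sP)) => v vs2.
by apply: Ps; rewrite mem_cat map_f ?orbT.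
Qed.

Lemma flat_deformation : valuation_ring V ->
  (forall v w : V, v * w = 0 -> v = 0 \/ w = 0) ->
  flat (restr (tinr i j) deformation).
Proof.
move=> valV domV; apply: torsion_free_flat => // v q vq0.
have [v0|v0] := pselect (v = 0); [by left|right].
have vr : regular_elt LV (tinr i j v).
  by apply: tinr_regular => w /domV[].
by apply: val_inj; apply: vr; have := congr1 val vq0.
Qed.

(** By [Phi_Psi], the image of [Phi] contains [t^2 x^2 (L (x) V)], hence
    [t^2] times the deformation. *)
Lemma generic_fibre :
  lmod_iso (restr (tloc i j t) (loc (powers t') deformation))
           (tmod i (to_loc_alg j t) (submod M) (locr (powers t))^o).
Proof.
apply: (@loc_lmod_iso _ _ _ i j t _ _ Phi_corestr).
- by move=> u v /(congr1 val) /=; exact: Phi_inj.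
- exact: tinr_regular.
move=> q; have /mem_deformation[u [w ew]] := valP q.
exists 2%N, (t' ^+ 2 *: u - Psi w); apply: val_inj.
rewrite /= (linearB Phi) /= Phi_Psi (linearZ_LR Phi) scaleNr opprK.
by rewrite -[X in _ = _ + X]scalerA -scalerDr -ew.
Qed.

Variable at0 : V -> k.
Hypotheses (at0D : {morph at0 : v w / v + w}).
Hypotheses (at0Z : forall c v, at0 (j c * v) = c * at0 v).
Hypotheses (at01 : at0 1 = 1) (at0t : forall v, at0 (t * v) = 0).
Hypothesis at0_decomp : forall v, exists w, v = j (at0 v) + t * w.

Local Notation ev := (@ev k R V i j at0 _).

Lemma ev_Phi u : ev (Phi u) = alpha (val (ev u)).
Proof.
rewrite /Phi (evD at0D at0Z) -scalerA (ev_tinr at0D at0Z at0t) addr0.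
by rewrite !(ev_tmap at0D at0Z).
Qed.

(** Write [Q] for the deformation.  Modulo [t Q], an element of the kernel of
    evaluation is
    [Phi (m (x) 1) + x^2 (l (x) 1)] with [alpha m + x^2 l = 0], which is
    [t (x m (x) 1)].  If [l = alpha l'] and [m + x^2 l' = alpha l''], then
    [x m = x (alpha l'') - x^3 l'], and
    [x (alpha l'') = Phi (x l'') - t x^2 l''] is in [Q]. *)
Lemma ev_deformation_eq0 z :
  in_deformation z -> ev z = 0 -> exists2 z', in_deformation z' & z = t' *: z'.
Proof.
have sF := submodule_deformation.
move=> [u [w ->]]; rewrite (evD at0D at0Z) (ev_tinl at0D at0Z) ev_Phi.
have [u' eu] := ev_decomp at0D at0Z at0_decomp u.
have [w' ew] := ev_decomp at0D at0Z at0_decomp w.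
rewrite {2}eu {2}ew; move: (ev u) (ev w) => m l ml {u w eu ew}.
have [l' el] : exists l', l = alpha l'.
  apply/im_ker/x_reg/x_reg; rewrite scalerA -expr2 -(linearZ_LR alpha).
  rewrite -[x ^+ 2 *: l](addKr (alpha (val m))) ml addr0.
  by rewrite (linearN alpha) /= (alpha_alpha im_ker) oppr0.
have [l'' em] : exists l'', val m + x ^+ 2 *: l' = alpha l''.
  by apply/im_ker; rewrite (linearD alpha) (linearZ_LR alpha) -el.
pose z0 := Phi (ptens i j (mulxM l'') (1 : V^o)) +
  tinl i j (x ^+ 2) *:
    - (ptens i j l'' (t : V^o) + ptens i j (x *: l') (1 : V^o)).
have z0E : z0 = ptens i j (x *: val m) (1 : V^o).
  rewrite /z0 PhiE scalerN scalerDr !ptensE !scale1r mulr1 /= opprD addrA.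
  rewrite scalerA -expr2 addrK (linearZ_LR alpha) -em scalerDr ptensDl.
  by rewrite !scalerA mulrC addrK.
have mlE : Phi (ptens i j m (1 : V^o)) +
    tinl i j (x ^+ 2) *: ptens i j l (1 : V^o) = t' *: z0.
  rewrite z0E PhiE !ptensE !scale1r addrAC -ptensDl ml ptens0l add0r.
  by [].
have Fz0 : in_deformation z0 by do 2 eexists.
exists (Phi u' + tinl i j (x ^+ 2) *: w' + z0).
  by apply: submoduleD => //; exists u', w'.
clearbody z0.
rewrite (linearD Phi) (linearZ_LR Phi) /=.
move: (Phi u') (Phi (ptens _ _ m _)) mlE => p q mlE.
by rewrite !scalerDr -mlE addrACA addrC !scalerA mulrC.
Qed.

Lemma special_fibre (N : submodClosed L) :
  (forall u, u \in N <-> exists m l, m \in M /\ u = alpha m + x ^+ 2 *: l) ->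
  lmod_iso (restr (tinl i j) (quotm (ideal_mul deformation [:: t'])))
    (submod N).
Proof.
move=> memN.
have evN (q : deformation) : ev (val q) \in N.
  have /mem_deformation[u [w ->]] := valP q; apply/memN.
  exists (val (ev u)), (ev w); split; first exact: valP.
  by rewrite (evD at0D at0Z) (ev_tinl at0D at0Z) ev_Phi.
apply: (quotm_lmod_iso (f := fun q : deformation => Submod (evN q))).
- by move=> q q'; apply: val_inj; exact: evD.
- by move=> a q; apply: val_inj; exact: ev_tinl.
- move=> y; have /memN[m [l [Mm ey]]] := valP y.
  have Fz : Phi (ptens i j (Submod Mm) (1 : V^o)) +
      tinl i j (x ^+ 2) *: ptens i j l (1 : V^o)
      \in pred_of_submodule submodule_deformation.
    by apply/mem_deformation; do 2 eexists.
  exists (Submod Fz); apply: val_inj; rewrite /= ey.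
  by rewrite (evD at0D at0Z) (ev_tinl at0D at0Z) ev_Phi !ev1.
- move=> q; rewrite mem_ideal_mul1; split=> [/(congr1 val) /= q0|[q' ->]].
    have [|z /mem_deformation Fz ez] := ev_deformation_eq0 _ q0.
      by apply/mem_deformation; exact: valP.
    by exists (Submod Fz); apply: val_inj.
  by apply: val_inj; exact: ev_tinr.
Qed.
End Deformation.

(** * The theorem *)

Lemma degenerates_alpha_sq (k : fieldType) (R : comPzRingType)
    (i : {rmorphism k -> R}) (L : lmodType R) (alpha : {linear L -> L})
    (x : R) (M N : submodClosed L) :
  (forall y, alpha y = 0 <-> exists z, y = alpha z) -> regular_elt L x ->
  (forall u, alpha u \in M) -> (forall u, x *: u \in M) ->
  (forall u, u \in N <-> exists m l, m \in M /\ u = alpha m + x ^+ 2 *: l) ->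
  fin_gen L -> fin_gen (submod M) -> fin_gen (submod N) ->
  degenerates i (submod M) (submod N).
Proof.
move=> im_ker x_reg aM xM memN fgL fgM fgN.
pose V : idomainType := locpoly k; pose t : V := locpolyX k.
pose j : {rmorphism k -> V} := @locpolyC k.
have t_reg : regular_elt V^o t.
  by move=> v /eqP; rewrite mulf_eq0 (negPf (locpolyX_neq0 k)) => /eqP.
have at0Z c v : at0 (j c * v) = c * at0 v by rewrite at0M at0C.
have at01 : at0 (1 : V) = 1 by rewrite -[1 in RHS]at0C rmorph1.
have at0t v : at0 (t * v) = 0 by rewrite at0M at0X mul0r.
exists V, j, t, (deformation i j t alpha x M); split=> //.
- split; [exact: locpoly_dvr|exact: locpoly_nonunit|exact: locpoly_residue].
- split; first exact: fin_gen_deformation.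
  apply: flat_deformation => //; first exact: locpoly_valuation.
  move=> v w /eqP; rewrite mulf_eq0.
  by case/orP=> /eqP; [left|right].
- exact: (special_fibre i im_ker x_reg xM (@at0D k) at0Z at01 at0t
    (@locpoly_decomp k) memN).
- exact: generic_fibre.
Qed.

Theorem theorem1p2 (k : fieldType) (R : comPzRingType)
    (i : {rmorphism k -> R}) (R_noeth : noetherian R)
    (L : lmodType R) (L_fg : fin_gen L)
    (alpha : {linear L -> L})
    (im_ker : im_sub alpha (full_sub L) =i [pred y : L | alpha y == 0])
    (x : R) (x_reg : regular_elt L x)
    (M : submodClosed L)
    (M_sub : {subset add_sub (im_sub alpha (full_sub L)) (ideal_mul L [:: x])
               <= M}) :
  let N : submodClosed L :=
    add_sub (im_sub alpha M) (ideal_mul L [:: x ^+ 2]) in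
  degenerates i (submod M) (submod N) /\
  (cohen_macaulay L -> cohen_macaulay (submod M) -> cohen_macaulay (submod N)).
Proof.
have nR := noetherian_noetherian_mod R_noeth.
have nL := noetherian_fin_gen nR L_fg.
have fg (S : submodClosed L) : fin_gen (submod S).
  exact/fin_gen_submod/nL/submodule_mem.
split; last exact: cohen_macaulay_alpha_sq.
apply: (@degenerates_alpha_sq k R i L alpha x) => //.
- exact: im_kerP.
- exact: (alpha_mem M_sub).
- exact: (x_mem M_sub).
- exact: mem_N.
Qed.
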